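(* The family of probability measures $\{P_\theta:\theta\in\mathcal{A}^\Theta_{0,\infty}\}$ on $C_0^d(\mathbb{R}^+)$ is tight.
   Context: $C_0^d(\mathbb{R}^+)$ is the space of continuous paths $\omega:[0,\infty)\to\mathbb{R}^d$ with $\omega_0=0$, with the distance $\rho(\omega^1,\omega^2)=\sum_{i\ge1}2^{-i}[(\max_{t\in[0,i]}|\omega^1_t-\omega^2_t|)\wedge1]$ and its Borel $\sigma$-algebra. $\Theta$ is a given nonempty, bounded and closed subset of $\mathbb{R}^{d\times d}$. $(\bar\Omega,\mathcal{F},P)$ is a probability space carrying a $d$-dimensional Brownian motion $W$, with $\mathcal{F}_t=\sigma\{W_u:0\le u\le t\}\vee\{P\text{-null sets}\}$. $\mathcal{A}^\Theta_{0,\infty}$ is the collection of all $\Theta$-valued $(\mathcal{F}_t)$-adapted (jointly measurable) processes on $[0,\infty)$. For $\theta\in\mathcal{A}^\Theta_{0,\infty}$, $P_\theta$ is the law on $C_0^d(\mathbb{R}^+)$ of the process $t\mapsto\int_0^t\theta_s\,dW_s$, $t\ge0$. *)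

(* Defs.v *)
From HB Require Import structures.
From mathcomp Require Import all_boot all_order all_algebra.
From mathcomp Require Import all_classical all_reals all_analysis.
From mathcomp Require Import ring lra.

Set Implicit Arguments.
Unset Strict Implicit.
Unset Printing Implicit Defensive.

Import Order.TTheory GRing.Theory Num.Theory.
Import numFieldNormedType.Exports.

Local Open Scope classical_set_scope.
Local Open Scope ring_scope.

(* Euclidean norm of a column vector, Frobenius norm of a matrix; the library
   norm `|A| on matrices is the max norm. *)
Definition sqnorm (R : realType) m n (A : 'M[R]_(m, n)) : R :=
  \sum_i \sum_j A i j ^+ 2.

Definition enorm (R : realType) m n (A : 'M[R]_(m, n)) : R :=
  Num.sqrt (sqnorm A).

Section enorm_theory.
Context {R : realType} {m n : nat}.
Implicit Types A B : 'M[R]_(m, n).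

Let dot A B : R := \sum_i \sum_j A i j * B i j.

Lemma sqnorm_ge0 A : 0 <= sqnorm A.
Proof.
by apply: sumr_ge0 => i _; apply: sumr_ge0 => j _; exact: sqr_ge0.
Qed.

Lemma enorm_ge0 A : 0 <= enorm A.
Proof. exact: sqrtr_ge0. Qed.

Lemma sqr_enorm A : enorm A ^+ 2 = sqnorm A.
Proof. by rewrite sqr_sqrtr// sqnorm_ge0. Qed.

Lemma enorm0 : enorm (0 : 'M[R]_(m, n)) = 0.
Proof.
rewrite /enorm /sqnorm big1 ?sqrtr0// => i _.
by rewrite big1// => j _; rewrite mxE expr0n.
Qed.

Lemma enormN A : enorm (- A) = enorm A.
Proof.
congr Num.sqrt; apply: eq_bigr => i _; apply: eq_bigr => j _.
by rewrite mxE sqrrN.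
Qed.

Lemma enorm_eq0 A : enorm A = 0 -> A = 0.
Proof.
move=> A0; have : sqnorm A = 0 by rewrite -sqr_enorm A0 expr0n.
move=> /psumr_eq0P S0; apply/matrixP => i j; rewrite mxE.
have {}S0 : \sum_j A i j ^+ 2 = 0.
  by apply: S0 => // k _; apply: sumr_ge0 => l _; exact: sqr_ge0.
have /psumr_eq0P/(_ j isT)/eqP := S0.
by rewrite sqrf_eq0 => H; apply/eqP/H => k _; exact: sqr_ge0.
Qed.

Let sqnorm_lin a b A B :
  sqnorm (a *: A + b *: B) =
  a ^+ 2 * sqnorm A + 2 * a * b * dot A B + b ^+ 2 * sqnorm B.
Proof.
rewrite /sqnorm /dot !mulr_sumr -!big_split/=; apply: eq_bigr => i _.
rewrite !mulr_sumr -!big_split/=; apply: eq_bigr => j _.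
by rewrite !mxE; ring.
Qed.

Let dot_le A B : dot A B <= enorm A * enorm B.
Proof.
have [A0|An0] := eqVneq (enorm A) 0.
  rewrite A0 mul0r (enorm_eq0 A0) /dot big1// => i _.
  by rewrite big1// => j _; rewrite mxE mul0r.
have [B0|Bn0] := eqVneq (enorm B) 0.
  rewrite B0 mulr0 (enorm_eq0 B0) /dot big1// => i _.
  by rewrite big1// => j _; rewrite mxE mulr0.
have a0 : 0 < enorm A by rewrite lt_neqAle eq_sym An0 enorm_ge0.
have b0 : 0 < enorm B by rewrite lt_neqAle eq_sym Bn0 enorm_ge0.
have := sqnorm_ge0 (enorm B *: A + (- enorm A) *: B).
rewrite sqnorm_lin -!sqr_enorm.
have -> : enorm B ^+ 2 * enorm A ^+ 2 + 2 * enorm B * - enorm A * dot A B +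
    (- enorm A) ^+ 2 * enorm B ^+ 2 =
    2 * (enorm A * enorm B) * (enorm A * enorm B - dot A B) by ring.
by rewrite pmulr_rge0 ?mulr_gt0// subr_ge0.
Qed.

Lemma enormD A B : enorm (A + B) <= enorm A + enorm B.
Proof.
rewrite -(@ler_pXn2r _ 2)// ?nnegrE ?addr_ge0 ?enorm_ge0//.
rewrite sqr_enorm -[A]scale1r -[B]scale1r sqnorm_lin !scale1r.
rewrite sqrrD !sqr_enorm expr1n !mul1r !mulr1 lerD2r lerD2l.
by have := dot_le A B; lra.
Qed.

Lemma sqnorm_le A : sqnorm A <= (m * n)%:R * `|A| ^+ 2.
Proof.
have AE i j : A i j ^+ 2 <= `|A| ^+ 2.
  rewrite -[leLHS]real_normK ?num_real// ler_pXn2r// ?nnegrE//.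
  by rewrite [leRHS]/Num.norm/= mx_normrE; exact: (le_bigmax _ _ (i, j)).
apply: (@le_trans _ _ (\sum_(i < m) \sum_(j < n) `|A| ^+ 2)).
  by apply: ler_sum => i _; apply: ler_sum => j _.
by rewrite !sumr_const !card_ord -mulrnA mulnC mulr_natl.
Qed.

End enorm_theory.

(* C_0^d(R^+): since w_0 = 0, continuous paths on [0, +oo[ starting at 0 are
   exactly the continuous functions on R that vanish on ]-oo, 0]; this makes
   Leibniz equality of cpath the equality of paths on [0, +oo[. *)
Record cpath (R : realType) (d : nat) := CPath {
  cpath_fun :> R -> 'cV[R]_d ;
  cpath_continuous : continuous cpath_fun ;
  cpath_eq0 : forall t, t <= 0 -> cpath_fun t = 0 }.

HB.instance Definition _ (R : realType) d := gen_eqMixin (cpath R d).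
HB.instance Definition _ (R : realType) d := gen_choiceMixin (cpath R d).

Definition cpath0 (R : realType) d : cpath R d :=
  @CPath R d (cst 0) (fun _ => cvg_cst _) (fun _ _ => erefl).

HB.instance Definition _ (R : realType) d :=
  isPointed.Build (cpath R d) (cpath0 R d).

Definition max_dist (R : realType) d (T : R) (a b : cpath R d) : R :=
  sup [set enorm (a t - b t) | t in `[0, T]].

(* The term of index k below is the one of index i = k + 1 in
   \sum_(i >= 1) 2^-i [(max_(t in [0, i]) |a_t - b_t|) /\ 1]. *)
Definition rho_term (R : realType) d (a b : cpath R d) (k : nat) : R :=
  2^-1 ^+ k.+1 * Num.min (max_dist k.+1%:R a b) 1.

Definition rho (R : realType) d (a b : cpath R d) : R :=
  limn (series (rho_term a b)).

Section rho_theory.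
Context {R : realType} {d : nat}.
Implicit Types a b c : cpath R d.

Lemma max_dist_has_sup T a b : 0 <= T ->
  has_sup [set enorm (a t - b t) | t in `[0, T]].
Proof.
move=> T0; split.
  by exists (enorm (a 0 - b 0)); exists 0 => //=; rewrite in_itv/= lexx.
have cf : {within `[0, T], continuous (fun t => a t - b t)}.
  apply: continuous_subspaceT => t.
  by apply: cvgB; exact: cpath_continuous.
have /compact_bounded[M [_ HM]] :=
  continuous_compact cf (@segment_compact _ 0 T).
exists (Num.sqrt ((d * 1)%:R * (M + 1) ^+ 2)) => _ [t tT <-].
have tM : `|a t - b t| <= M + 1.
  by apply: (HM (M + 1)); [rewrite ltrDl|exists t].
rewrite ler_wsqrtr// (le_trans (sqnorm_le _))// ler_wpM2l//.
by rewrite ler_pXn2r// nnegrE// (le_trans _ tM).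
Qed.

Lemma max_dist_ub T a b t : 0 <= t <= T -> enorm (a t - b t) <= max_dist T a b.
Proof.
move=> /andP[t0 tT]; apply: ub_le_sup.
  by have [] := max_dist_has_sup a b (le_trans t0 tT).
by exists t => //=; rewrite in_itv/= t0.
Qed.

Lemma max_dist_le T a b x : 0 <= T ->
  (forall t, 0 <= t <= T -> enorm (a t - b t) <= x) -> max_dist T a b <= x.
Proof.
move=> T0 H; apply: ge_sup; first by have [] := max_dist_has_sup a b T0.
by move=> x' [t /=]; rewrite in_itv/= => tT <-; exact: H.
Qed.

Lemma max_dist_ge0 T a b : 0 <= T -> 0 <= max_dist T a b.
Proof.
move=> T0; apply: le_trans (enorm_ge0 (a 0 - b 0)) _.
by apply: max_dist_ub; rewrite lexx.
Qed.

Lemma rho_term_ge0 a b k : 0 <= rho_term a b k.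
Proof. by rewrite mulr_ge0 ?exprn_ge0// le_min max_dist_ge0 ?ler01. Qed.

Lemma rho_term_le a b k : rho_term a b k <= 2^-1 ^+ k.+1.
Proof. by rewrite ler_piMr ?exprn_ge0// ge_min lexx orbT. Qed.

Lemma is_cvg_rho a b : cvgn (series (rho_term a b)).
Proof.
apply: (@series_le_cvg _ _ (geometric 2^-1 2^-1)).
- exact: rho_term_ge0.
- by move=> k; rewrite /= mulr_ge0// exprn_ge0.
- by move=> k; rewrite /= -exprS; exact: rho_term_le.
- by apply: is_cvg_geometric_series; rewrite ger0_norm//; lra.
Qed.

Lemma rhoxx a : rho a a = 0.
Proof.
rewrite /rho (_ : rho_term a a = cst 0).
  rewrite (_ : series _ = cst 0) ?lim_cst//.
  by apply/funext => n; rewrite /series/= big1.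
apply/funext => k; rewrite /rho_term (_ : max_dist _ _ _ = 0).
  by rewrite min_l// mulr0.
apply/eqP; rewrite eq_le max_dist_ge0// andbT.
by apply: max_dist_le => // t _; rewrite subrr enorm0.
Qed.

Lemma rho_sym a b : rho a b = rho b a.
Proof.
congr (limn (series _)); apply/funext => k.
rewrite /rho_term (_ : max_dist k.+1%:R a b = max_dist k.+1%:R b a)//.
congr (sup (image _ _)); apply/funext => t.
by rewrite -opprB enormN.
Qed.

Lemma rho_positivity a b : rho a b = 0 -> a = b.
Proof.
move=> ab0.
have term0 k : rho_term a b k = 0.
  apply/eqP; rewrite eq_le rho_term_ge0 andbT -ab0.
  apply: (@le_trans _ _ (series (rho_term a b) k.+1)).
    by rewrite seriesEnat/= big_nat_recr//= lerDr sumr_ge0// => i _;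
      exact: rho_term_ge0.
  apply: nondecreasing_cvgn_le; last exact: is_cvg_rho.
  by apply/nondecreasing_seqP => j; rewrite !seriesEnat/= big_nat_recr//=
    lerDl rho_term_ge0.
have abE t : a t = b t.
  have [t0|t0] := leP t 0; first by rewrite (cpath_eq0 a)// (cpath_eq0 b).
  set k := Num.truncn t.
  have tk : t <= k.+1%:R by rewrite ltW// truncnS_gt.
  have /eqP := term0 k; rewrite mulf_eq0 expf_eq0/= invr_eq0 pnatr_eq0/=.
  move=> /eqP M0; have D0 : max_dist k.+1%:R a b = 0.
    by move: M0; rewrite minEle; case: ifP => // _ /eqP; rewrite oner_eq0.
  apply/eqP; rewrite -subr_eq0; apply/eqP/enorm_eq0/eqP.
  by rewrite eq_le enorm_ge0 andbT -D0 max_dist_ub// (ltW t0).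
case: a b {ab0 term0} abE => [f cf f0] [g cg g0]/= fg.
have {}fg : f = g by exact/funext.
by rewrite {}fg in cf f0 *; congr CPath; exact: Prop_irrelevance.
Qed.

Lemma rho_triangle b a c : rho a c <= rho a b + rho b c.
Proof.
rewrite /rho -lim_seriesD; [|exact: is_cvg_rho..].
apply: lim_series_le; first exact: is_cvg_rho.
  by apply: is_cvg_seriesD; exact: is_cvg_rho.
move=> k /=; rewrite /rho_term -mulrDr ler_wpM2l ?exprn_ge0//.
have ab := max_dist_ge0 a b (ler0n R k.+1).
have bc := max_dist_ge0 b c (ler0n R k.+1).
have abc : max_dist k.+1%:R a c <= max_dist k.+1%:R a b + max_dist k.+1%:R b c.
  apply: max_dist_le => // t tk.
  rewrite (_ : a t - c t = (a t - b t) + (b t - c t)); last first.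
    by rewrite addrA subrK.
  by apply: le_trans (enormD _ _) _; rewrite lerD ?max_dist_ub.
have minD (x y z : R) : 0 <= y -> 0 <= z -> x <= y + z ->
    Num.min x 1 <= Num.min y 1 + Num.min z 1.
  move=> y0 z0 xyz; rewrite ge_min.
  have [y1|y1] := leP y 1; have [z1|z1] := leP z 1; rewrite ?xyz//;
    by apply/orP; right; lra.
exact: minD.
Qed.

End rho_theory.

HB.instance Definition _ (R : realType) d :=
  isMetric.Build R (cpath R d) (@rhoxx R d) (@rho_positivity R d)
    (@rho_sym R d) (@rho_triangle R d).

Notation borel T := (g_sigma_algebraType (@open T)).
Notation borel_set T := ((@open T).-sigma.-measurable) (only parsing).

(* Compact sets are Borel in the (metric, hence Hausdorff) spaces of interest. *)
Definition tight (R : realType) (T : ptopologicalType)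
    (M : set (probability (borel T) R)) :=
  forall e : R, 0 < e -> exists K : set T,
    compact K /\ forall Q, M Q -> (Q (~` K) <= e%:E)%E.

Section ito.
Context {R : realType} {d : nat} {dOmega : measure_display}
  {Omega : measurableType dOmega} (P : probability Omega R) (W : R -> Omega -> 'cV[R]_d).
Local Notation mu := (@lebesgue_measure R).

(* the events {W_u in B}, 0 <= u <= t *)
Definition past_events (t : R) : set (set Omega) :=
  [set A | exists (u : R) B, [/\ 0 <= u <= t, borel_set 'cV[R]_d B &
                           A = W u @^-1` B]].

Definition null_events : set (set Omega) := [set N | measurable N /\ P N = 0%E].

Definition filtration (t : R) : set (set Omega) :=
  <<s past_events t `|` null_events >>.

Record brownian_motion : Prop := {
  bm_measurable : forall t : R, 0 <= t ->
    measurable_fun [set: Omega] (W t : Omega -> borel 'cV[R]_d) ;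
  bm_start : {ae P, forall w, W 0 w = 0} ;
  bm_continuous :
    {ae P, forall w, {within `[0, +oo[, continuous (W ^~ w)}} ;
  bm_independent_increments : forall s t : R, 0 <= s -> s < t ->
    forall A B, <<s past_events s >> A -> borel_set 'cV[R]_d B ->
    let incr := (fun w => W t w - W s w) @^-1` B in
    P (A `&` incr) = (P A * P incr)%E ;
  (* W_t - W_s has law N(0, (t - s) I_d); the second parameter of normal_prob
     is the standard deviation *)
  bm_gaussian_increments : forall s t : R, 0 <= s -> s < t ->
    forall B : 'I_d -> set R, (forall i, measurable (B i)) ->
    P [set w | forall i, B i ((W t w - W s w) i 0)] =
    (\prod_(i < d) normal_prob 0 (Num.sqrt (t - s)) (B i))%E }.

Definition filtration_measurable (T : ptopologicalType) (t : R) (Y : Omega -> T) :=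
  forall B, borel_set T B -> filtration t (Y @^-1` B).

Record admissible (Theta : set 'M[R]_d) (theta : R -> Omega -> 'M[R]_d) : Prop := {
  adm_jointly_measurable :
    measurable_fun ((`[0, +oo[ : set (measurableTypeR R)) `*` [set: Omega])
    (fun p : measurableTypeR R * Omega => theta p.1 p.2 : borel 'M[R]_d) ;
  adm_adapted : forall t : R, 0 <= t -> filtration_measurable t (theta t) ;
  adm_valued : forall (t : R) w, 0 <= t -> Theta (theta t w) }.

(* s |-> \sum_(k < n) xi_k 1_(]t_k, t_(k+1)])(s) *)
Record simple_process := SimpleProcess {
  sp_size : nat ;
  sp_time : nat -> R ;
  sp_coef : nat -> Omega -> 'M[R]_d ;
  sp_time0 : 0 <= sp_time 0 ;
  sp_time_le : forall k, sp_time k <= sp_time k.+1 ;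
  sp_bounded : forall k, exists M, forall w, enorm (sp_coef k w) <= M ;
  sp_adapted : forall k, filtration_measurable (sp_time k) (sp_coef k) }.

Definition simple_value (H : simple_process) (s : R) (w : Omega) : 'M[R]_d :=
  \sum_(k < sp_size H)
    \1_(`]sp_time H k, sp_time H k.+1]) s *: sp_coef H k w.

Definition simple_integral (H : simple_process) (t : R) (w : Omega) : 'cV[R]_d :=
  \sum_(k < sp_size H) sp_coef H k w *m
    (W (Num.min (sp_time H k.+1) t) w - W (Num.min (sp_time H k) t) w).

(* X is a continuous version of the Ito integral process of theta: the L^2
   limit of the integrals of simple processes approximating theta in
   L^2([0, T] x Omega) for every T. *)
Definition is_ito_integral (theta : R -> Omega -> 'M[R]_d) (X : Omega -> cpath R d) :=
  exists H : nat -> simple_process,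
    (forall T : R, 0 <= T ->
      (\int[P]_w \int[mu]_(s in `[0%R, T])
         (sqnorm (simple_value (H n) s w - theta s w))%:E)%E
      @[n --> \oo] --> 0%E) /\
    (forall t : R, 0 <= t ->
      (\int[P]_w (sqnorm (simple_integral (H n) t w - X w t))%:E)%E
      @[n --> \oo] --> 0%E).

(* Q is the law P_theta of the Ito integral of theta *)
Definition ito_law (theta : R -> Omega -> 'M[R]_d)
    (Q : probability (borel (cpath R d)) R) :=
  exists2 X : {RV P >-> borel (cpath R d)},
    is_ito_integral theta X & Q = distribution P X.

Definition ito_laws (Theta : set 'M[R]_d) :
    set (probability (borel (cpath R d)) R) :=
  [set Q | exists2 theta, admissible Theta theta & ito_law theta Q].

End ito.

(* Main.v *)
(* For a simple process H, E exp(c I(H)_i - (d^2 c^2 / 2) \int |H|^2 ds) <= 1 by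
   conditioning on the past one step at a time.  If the simple processes H_n
   approximate theta in L^2 and |theta|^2 <= B, then \int_s^t |H_n|^2 dr is at
   most 2 B (t - s) plus an error tending to 0 in L^1, so letting n tend to
   infinity gives the Gaussian-type tail
     P (c (X_t - X_s)_i >= x) <= exp (d^2 c^2 B (t - s) + 1 - x)
   with no truncation of H_n and no Ito isometry.  With c = (4/3)^n this
   bounds, uniformly in theta, the probability that some dyadic increment of
   level n on [0, 2^n] exceeds (9/10)^n by a geometric sequence.  The paths
   whose dyadic increments of all levels n >= n0 obey this bound form a compact
   set: they are equicontinuous on bounded intervals by chaining. *)

Require Import Defs.
From HB Require Import structures.
From mathcomp Require Import all_boot all_order all_algebra.
From mathcomp Require Import all_classical all_reals all_analysis.
From mathcomp Require Import measurable_realfun ring lra.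

Set Implicit Arguments.
Unset Strict Implicit.
Unset Printing Implicit Defensive.

Import Order.TTheory GRing.Theory Num.Theory.
Import numFieldNormedType.Exports.

Local Open Scope classical_set_scope.
Local Open Scope ring_scope.

(** * Gaussian integrals and independence *)

(** The coefficients of [H_n] are bounded by constants that may grow with n, and they are close to
    theta only in L^2. The compensator therefore carries the random quantity |H_n|^2 itself, so that
    the expectation bound 1 does not depend on these constants; the bound B on theta enters only
    afterwards, path by path. The approximation errors are paid for by Markov's inequality, and any
    factor in front of them is harmless since they vanish in the limit. The bases 4/3 and 9/10 are
    tied by three requirements. An increment of level n has length 2^-n, so (4/3)^2 <= 2 keeps c^2
    (t - s) bounded. Since (4/3)(9/10) = 6/5 > 1, the tail exp(-(6/5)^n) beats the number 4^n of
    intervals of level n. Finally 9/10 < 1 makes the chaining sum converge. *)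

(** The density and the Radon-Nikodym derivative have the same integral over every measurable set,
    hence agree almost everywhere, and the change of variables known for the derivative carries
    over. *)
Lemma ge0_integral_normal_prob (R : realType) (m s : R) (f : R -> \bar R) :
  measurable_fun [set: R] f -> (forall x, 0 <= f x)%E ->
  (\int[normal_prob m s]_x f x =
   \int[lebesgue_measure]_x (f x * (normal_pdf m s x)%:E))%E.
Proof.
move=> mf f0.
pose nu := normal_prob m s.
pose mu := @lebesgue_measure R.
have numu : nu `<< mu := normal_prob_dominates m s.
rewrite -(Radon_Nikodym_SigmaFinite.change_of_variables numu f0 measurableT mf).
apply: ae_eq_integral => //.
- apply: emeasurable_funM => //.
  exact: measurable_int (Radon_Nikodym_SigmaFinite.f_integrable numu).
- apply: emeasurable_funM => //.
  by apply/measurable_EFinP; exact: measurable_normal_pdf.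
have fE : ae_eq mu setT (Radon_Nikodym_SigmaFinite.f nu mu)
    (EFin \o normal_pdf m s).
  apply: integral_ae_eq => //.
  - exact: Radon_Nikodym_SigmaFinite.f_integrable.
  - by apply/measurable_EFinP; exact: measurable_normal_pdf.
  by move=> A _ mA; rewrite -Radon_Nikodym_SigmaFinite.f_integral.
by apply: filterS fE => x /= fx _; rewrite fx.
Qed.

(** Completing the square: tilting the centred density by exp(a x) gives the density centred at a
    s^2, up to the stated factor. *)
Lemma normal_prob_mgf (R : realType) (s a : R) : s != 0 ->
  (\int[normal_prob 0%R s]_x (expR (a * x))%:E =
   (expR (a ^+ 2 * s ^+ 2 / 2))%:E)%E.
Proof.
move=> s0; rewrite ge0_integral_normal_prob; last 2 first.
- by apply/measurable_EFinP; apply: measurableT_comp => //.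
- by move=> x; rewrite lee_fin expR_ge0.
transitivity (\int[@lebesgue_measure R]_x ((expR (a ^+ 2 * s ^+ 2 / 2))%:E *
    (normal_pdf (a * s ^+ 2) s x)%:E))%E.
  apply: eq_integral => x _; rewrite -!EFinM; congr EFin.
  rewrite !normal_pdfE// /normal_fun mulrCA [RHS]mulrCA -!expRD; congr (_ * expR _).
  by field; rewrite s0.
rewrite ge0_integralZl//.
- by rewrite integral_normal_pdf mule1.
- by apply/measurable_EFinP; exact: measurable_normal_pdf.
- by move=> x _; rewrite lee_fin normal_pdf_ge0.
Qed.

(* Independence of [U] and [Z] makes their joint law a product measure, to
   which Tonelli applies. *)
Lemma ge0_integral_independent {R : realType} d d1 d2 (T : measurableType d)
    (T1 : measurableType d1) (T2 : measurableType d2) (P : probability T R)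
    (U : T -> T1) (Z : T -> T2) (nu : probability T2 R) (g : T1 * T2 -> \bar R) :
  measurable_fun setT U -> measurable_fun setT Z ->
  (forall A B, measurable A -> measurable B ->
    P (U @^-1` A `&` Z @^-1` B) = (P (U @^-1` A) * nu B)%E) ->
  measurable_fun setT g -> (forall x, 0 <= g x)%E ->
  (\int[P]_w g (U w, Z w) = \int[P]_w \int[nu]_z g (U w, z))%E.
Proof.
move=> mU mZ UZ mg g0.
have mUZ : measurable_fun setT (fun w => (U w, Z w)).
  exact: measurable_fun_pair.
pose Um : {mfun T >-> T1} := HB.pack U (isMeasurableFun.Build _ _ _ _ _ mU).
pose PU : probability T1 R := distribution P Um.
have prodE : forall X, measurable X -> (PU \x nu)%E X =
    pushforward P (fun w => (U w, Z w)) X.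
  pose UZm : {mfun T >-> (T1 * T2)%type} :=
    HB.pack (fun w => (U w, Z w)) (isMeasurableFun.Build _ _ _ _ _ mUZ).
  apply: (@product_measure_unique _ _ _ _ R PU nu (distribution P UZm)).
  by move=> A B mA mB; rewrite -UZ.
transitivity (\int[(PU \x nu)%E]_x g x)%E.
  rewrite (@eq_measure_integral _ _ _ _ (pushforward P (fun w => (U w, Z w)))).
    by rewrite (ge0_integral_pushforward mUZ).
  by move=> A mA _; exact: prodE.
rewrite fubini_tonelli1// /fubini_F.
rewrite /PU /distribution (ge0_integral_pushforward mU)//.
  exact: measurable_fun_fubini_tonelli_F.
by move=> x _; exact: integral_ge0.
Qed.

(** * Increments of Brownian motion *)

Lemma continuous_measurable_borel {R : realType} (T : ptopologicalType)
    (f : T -> R) : continuous f ->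
  measurable_fun setT (f : borel T -> R).
Proof.
move=> /continuousP cf.
apply: (measurability _ (RGenOpens.measurableE R)) => _ [_ [a [b ->]] <-].
rewrite setTI; apply: sub_sigma_algebra; exact/cf/interval_open.
Qed.

Lemma measurable_coord {R : realType} m n (i : 'I_m) (j : 'I_n) :
  measurable_fun setT ((fun A => A i j) : borel 'M[R]_(m, n) -> R).
Proof. by apply: continuous_measurable_borel; exact: coord_continuous. Qed.

Section filtration.
Context {R : realType} {d : nat} {dO : measure_display}
  {Omega : measurableType dO} {P : probability Omega R}
  {W : R -> Omega -> 'cV[R]_d}.
Hypothesis hW : brownian_motion P W.

Local Notation FO t := (g_sigma_algebraType (past_events W t `|` null_events P)).

Lemma filtration_sub_measurable t : filtration P W t `<=` measurable.
Proof.
apply: smallest_sub; first exact: sigma_algebra_measurable.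
move=> A [[u [B [/andP[u0 _] mB ->]]]|[]//].
rewrite -[X in measurable X]setTI; exact: (bm_measurable hW).
Qed.

Lemma filtration_mono s t : s <= t -> filtration P W s `<=` filtration P W t.
Proof.
move=> st; apply: sub_smallest2r; first exact: smallest_sigma_algebra.
apply: setSU => A [u [B [/andP[u0 us] mB ->]]].
by exists u, B; rewrite u0 (le_trans us st).
Qed.

(** The independence axiom of [brownian_motion] speaks of the raw past, whereas adaptedness refers
    to the past completed by null events. The events almost everywhere equal to a raw past event
    form a sigma-algebra that contains both kinds of generators, which bridges the two. *)
Lemma filtration_ae t A : filtration P W t A ->
  exists2 A', <<s past_events W t >> A' & {ae P, forall w, A w <-> A' w}.
Proof.
move: A; rewrite -/(_ `<=` _); apply: smallest_sub; last first.
  move=> A [pA|[mA A0]].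
    by exists A; [exact: sub_sigma_algebra|exact: aeW].
  exists set0; first exact: sigma_algebra0.
  by exists A; split => // w /=; apply: contra_notP => nA; split.
split.
- by exists set0; [exact: sigma_algebra0|exact: aeW].
- move=> A [A' pA' AA']; exists (~` A').
    by rewrite -setTD; exact: sigma_algebraCD.
  by apply: filterS AA' => w AA'; rewrite setTD /setC/=; tauto.
- move=> F pF; have [F' pF'] := choice (fun n => let: ex_intro2 A' p q := pF n in
    ex_intro (fun A' => _ /\ _) A' (conj p q)).
  exists (\bigcup_n F' n).
    by apply: sigma_algebra_bigcup => n; have [] := pF' n.
  have : {ae P, forall w, forall n, F n w <-> F' n w}.
    by apply: ae_foralln => n; have [] := pF' n.
  by apply: filterS => w FF'; split => -[n _ /FF' ?]; exists n.
Qed.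

Lemma past_sub_measurable t : <<s past_events W t >> `<=` measurable.
Proof.
apply: smallest_sub; first exact: sigma_algebra_measurable.
move=> A [u [B [/andP[u0 _] mB ->]]].
rewrite -[X in measurable X]setTI; exact: (bm_measurable hW).
Qed.

Lemma measurable_increment s t i : 0 <= s -> 0 <= t ->
  measurable_fun setT (fun w => (W t w - W s w) i 0).
Proof.
move=> s0 t0; rewrite (_ : (fun _ => _) = fun w => W t w i 0 - W s w i 0).
  apply: measurable_funB.
  - by have := measurableT_comp (measurable_coord (n := 1) i 0) (bm_measurable hW t0).
  - by have := measurableT_comp (measurable_coord (n := 1) i 0) (bm_measurable hW s0).
by apply/funext => w; rewrite !mxE.
Qed.

Lemma increment_law s t i B : 0 <= s -> s < t -> measurable B ->
  P ((fun w => (W t w - W s w) i 0) @^-1` B) =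
  normal_prob 0 (Num.sqrt (t - s)) B.
Proof.
move=> s0 st mB.
(* The marginal law comes from a box whose other sides are the whole line, each contributing a
   factor 1. *)
have := bm_gaussian_increments hW s0 st
  (B := fun j => if j == i then B else setT).
rewrite (bigD1 i)//= eqxx big1 ?mule1; last first.
  by move=> j /negbTE ->; exact: probability_setT.
move=> <-; last by move=> j; case: ifP.
congr (P _); apply/seteqP; split => w /=.
  by move=> Bw j; case: eqP => [->|].
by move=> /(_ i); rewrite eqxx.
Qed.

(** Replacing [A] by an almost everywhere equal event of the raw past changes neither probability,
    and for that event independence is part of the definition of Brownian motion. *)
Lemma increment_independent s t i A B : 0 <= s -> s < t ->
  filtration P W s A -> measurable B ->
  P (A `&` (fun w => (W t w - W s w) i 0) @^-1` B) =
  (P A * normal_prob 0 (Num.sqrt (t - s)) B)%E.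
Proof.
move=> s0 st FA mB; have [A' pA' AA'] := filtration_ae FA.
have mA := filtration_sub_measurable FA.
have mA' := past_sub_measurable pA'.
have mZ : measurable ((fun w => (W t w - W s w) i 0) @^-1` B).
  rewrite -[X in measurable X]setTI.
  exact: (measurable_increment i s0 (le_trans s0 (ltW st))).
have PE C D : measurable C -> measurable D ->
    {ae P, forall w, C w <-> D w} -> P C = P D.
  move=> mC mD CD; rewrite -[C]setIT -[D]setIT -!integral_indic//.
  apply: ae_eq_integral => //; [exact/measurable_EFinP..|].
  by apply: filterS CD => w /= CD _; congr (_%:E); rewrite !indicE;
    have -> : (w \in C) = (w \in D) by apply/idP/idP; rewrite !inE => /CD.
rewrite -(increment_law i s0 st mB) (PE A A')// -[in RHS](PE A A')//.
rewrite (PE _ (A' `&` (fun w => (W t w - W s w) i 0) @^-1` B)).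
- rewrite (PE A A')//.
  have := bm_independent_increments hW s0 st pA'
    (B := (fun v : 'cV[R]_d => v i 0) @^-1` B).
  apply.
  by rewrite -[X in measurable X]setTI; exact: (measurable_coord i 0).
- exact: measurableI.
- exact: measurableI.
by apply: filterS AA' => w AA' /=; tauto.
Qed.

Lemma measurable_filtration_fun t d' (T : measurableType d') (f : Omega -> T) :
  measurable_fun setT (f : FO t -> T) -> measurable_fun setT f.
Proof. by move=> mf _ B mB; apply: (@filtration_sub_measurable t); exact: mf. Qed.

(** Tonelli replaces conditional expectation: with the past frozen, the integral over the Gaussian
    increment is exp(b^2 (t - s) / 2), which [c] compensates. *)
Lemma integral_exp_increment1 s t (F b c : Omega -> R) i :
  0 <= s -> s < t -> (forall w, 0 <= F w) ->
  measurable_fun setT (F : FO s -> R) -> measurable_fun setT (b : FO s -> R) ->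
  measurable_fun setT (c : FO s -> R) ->
  (forall w, b w ^+ 2 * (t - s) / 2 <= c w) ->
  (\int[P]_w (F w * expR (b w * (W t w - W s w) i 0 - c w))%:E <=
   \int[P]_w (F w)%:E)%E.
Proof.
move=> s0 st F0 mF mb mc bc.
pose sg := Num.sqrt (t - s).
have ts0 : 0 < t - s by rewrite subr_gt0.
have sg0 : sg != 0 by rewrite gt_eqF// sqrtr_gt0.
pose g (p : FO s * measurableTypeR R) : \bar R :=
  (F p.1 * expR (- c p.1) * expR (b p.1 * p.2))%:E.
have mFc : measurable_fun setT ((fun w => F w * expR (- c w)) : FO s -> R).
  apply: measurable_funM => //; apply: measurableT_comp => //.
  exact: measurableT_comp.
have mg : measurable_fun setT g.
  apply/measurable_EFinP; apply: measurable_funM.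
    by apply: (measurableT_comp mFc); exact: measurable_fst.
  apply: measurableT_comp => //; apply: measurable_funM => //.
  by apply: (measurableT_comp mb); exact: measurable_fst.
have gE w : (F w * expR (b w * (W t w - W s w) i 0 - c w))%:E =
    g (w, (W t w - W s w) i 0).
  by rewrite /g/= addrC expRD mulrA.
under eq_integral do rewrite gE.
(* The variable that stands for the whole past is the identity, with target sigma-algebra the
   filtration at time [s]; [F], [b] and [c] are functions of it. *)
rewrite (ge0_integral_independent (U := (id : Omega -> FO s))
  (Z := (fun w => (W t w - W s w) i 0) : Omega -> measurableTypeR R)
  (nu := normal_prob 0 sg) _ _ _ mg).
- apply: ge0_le_integral => //.
  + by move=> w _; apply: integral_ge0 => z _; rewrite lee_fin !mulr_ge0 ?expR_ge0.
  + apply: (@measurable_filtration_fun s).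
    have g0 p : (0 <= g p)%E by rewrite lee_fin !mulr_ge0 ?expR_ge0.
    exact: (measurable_fun_fubini_tonelli_F (m2 := normal_prob 0 sg) g mg g0).
  + by apply/measurable_EFinP; exact: (@measurable_filtration_fun s).
  move=> w _; rewrite /g/=.
  under eq_integral do rewrite EFinM.
  rewrite ge0_integralZl//; last 2 first.
  + apply/measurable_EFinP; apply: measurableT_comp => //.
  + by rewrite lee_fin mulr_ge0 ?expR_ge0.
  rewrite normal_prob_mgf// -EFinM lee_fin -(mulrA (F w)) -expRD ler_piMr//.
  by rewrite -[leRHS]expR0 ler_expR sqr_sqrtr ?(ltW ts0)// addrC subr_le0.
- by move=> _ B mB; rewrite setTI; exact: (@filtration_sub_measurable s).
- exact: measurable_increment (le_trans s0 (ltW st)).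
- by move=> A B mA mB; exact: increment_independent.
- by move=> p; rewrite lee_fin !mulr_ge0 ?expR_ge0.
Qed.

(** Jensen for the points n x_j, whose mean is m = \sum_j x_j: each exponential lies above the
    tangent line at m, and the deviations from m sum to 0. *)
Lemma expR_sum_le n (x : 'I_n -> R) : (0 < n)%N ->
  expR (\sum_j x j) <= n%:R^-1 * \sum_j expR (n%:R * x j).
Proof.
move=> n0; set m := \sum_j x j.
have nR : 0 < n%:R :> R by rewrite ltr0n.
rewrite ler_pdivlMl//.
apply: (@le_trans _ _ (\sum_(j < n) expR m * (1 + (n%:R * x j - m)))).
  rewrite -mulr_sumr big_split/= sumrB -mulr_sumr -/m !sumr_const card_ord.
  by rewrite -[m *+ n]mulr_natl subrr addr0 mulrC.
apply: ler_sum => j _.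
rewrite [leRHS](_ : _ = expR m * expR (n%:R * x j - m)).
  by rewrite ler_pM2l ?expR_gt0// expR_ge1Dx.
by rewrite -expRD addrC subrK.
Qed.

(* By convexity the exponential of the sum over the coordinates is at most the
   mean of one-coordinate exponentials, so only the marginal laws of the
   increment matter; this costs the factor [d ^ 2] in the compensator. *)
Lemma integral_exp_increment s t (F v : Omega -> R) (a : 'I_d -> Omega -> R) :
  (0 < d)%N -> 0 <= s -> s < t -> (forall w, 0 <= F w) ->
  measurable_fun setT (F : FO s -> R) ->
  (forall j, measurable_fun setT (a j : FO s -> R)) ->
  measurable_fun setT (v : FO s -> R) ->
  (forall w, \sum_j a j w ^+ 2 <= v w) ->
  (\int[P]_w (F w * expR (\sum_j a j w * (W t w - W s w) j 0 -
     d%:R ^+ 2 / 2 * v w * (t - s)))%:E <= \int[P]_w (F w)%:E)%E.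
Proof.
move=> d0 s0 st F0 mF ma mv av.
have dR : 0 < d%:R :> R by rewrite ltr0n.
have t0 := le_trans s0 (ltW st).
pose c w := d%:R ^+ 2 / 2 * v w * (t - s).
have mc : measurable_fun setT (c : FO s -> R).
  by apply: measurable_funM => //; exact: measurable_funM.
have mb j : measurable_fun setT ((fun w => d%:R * a j w) : FO s -> R).
  exact: measurable_funM.
have mt j : measurable_fun setT (fun w =>
    (F w * expR (d%:R * a j w * (W t w - W s w) j 0 - c w))).
  apply: measurable_funM; first exact: (@measurable_filtration_fun s).
  apply: measurableT_comp => //; apply: measurable_funB.
    apply: measurable_funM; first exact: (@measurable_filtration_fun s).
    exact: measurable_increment.
  exact: (@measurable_filtration_fun s).
apply: (@le_trans _ _ (\int[P]_w (\sum_(j < d) (d%:R^-1)%:E *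
    (F w * expR (d%:R * a j w * (W t w - W s w) j 0 - c w))%:E))%E).
  apply: ge0_le_integral => //.
  - by move=> w _; rewrite lee_fin mulr_ge0 ?expR_ge0.
  - apply/measurable_EFinP; apply: measurable_funM.
      exact: (@measurable_filtration_fun s).
    apply: measurableT_comp => //; apply: measurable_funB; last first.
      exact: (@measurable_filtration_fun s).
    apply: measurable_sum => j; apply: measurable_funM.
      exact: (@measurable_filtration_fun s).
    exact: measurable_increment.
  - apply: emeasurable_sum => j; apply: measurable_funeM.
    exact/measurable_EFinP.
  move=> w _ /=; rewrite (eq_bigr _ (fun j _ => esym (EFinM _ _))) sumEFin lee_fin -/(c w).
  have -> : \sum_(j < d) d%:R^-1 *
      (F w * expR (d%:R * a j w * (W t w - W s w) j 0 - c w)) =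
      F w * expR (- c w) *
      (d%:R^-1 * \sum_j expR (d%:R * (a j w * (W t w - W s w) j 0))).
    rewrite !mulr_sumr; apply: eq_bigr => j _.
    by rewrite expRD -(mulrA d%:R); ring.
  rewrite addrC expRD mulrA ler_wpM2l ?mulr_ge0 ?expR_ge0//.
  exact: expR_sum_le.
rewrite ge0_integral_sum//; last 2 first.
- by move=> j; apply: measurable_funeM; exact/measurable_EFinP.
- by move=> j w _; rewrite -EFinM lee_fin !mulr_ge0 ?expR_ge0 ?invr_ge0//.
apply: (@le_trans _ _ (\sum_(j < d) (d%:R^-1)%:E * \int[P]_w (F w)%:E)%E).
  apply: lee_sum => j _.
  rewrite ge0_integralZl//; last 2 first.
  - exact/measurable_EFinP.
  - by move=> w _; rewrite lee_fin mulr_ge0 ?expR_ge0.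
  rewrite lee_wpmul2l ?lee_fin ?invr_ge0//.
  (* The one-coordinate bound is used with coefficient d a_j; its square yields the factor d^2, and
     a_j^2 is at most the full sum of squares, hence at most [v]. *)
  apply: integral_exp_increment1 => // w.
  rewrite /c [leLHS](_ : _ = d%:R ^+ 2 / 2 * (t - s) * a j w ^+ 2); last by ring.
  rewrite [leRHS](_ : _ = d%:R ^+ 2 / 2 * (t - s) * v w); last by ring.
  rewrite ler_wpM2l ?mulr_ge0 ?sqr_ge0 ?subr_ge0 ?(ltW st)//.
  apply: le_trans (av w); rewrite (bigD1 j)//= lerDl.
  by apply: sumr_ge0 => k _; exact: sqr_ge0.
rewrite -ge0_sume_distrl; last by move=> j _; rewrite lee_fin invr_ge0.
rewrite sumEFin sumr_const card_ord -[_ *+ d]mulr_natl divff ?mul1e//.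
by rewrite gt_eqF.
Qed.
End filtration.

(** * Exponential supermartingales of simple processes *)

Section simple_exponential.
Context {R : realType} {d : nat} {dO : measure_display}
  {Omega : measurableType dO} {P : probability Omega R}
  {W : R -> Omega -> 'cV[R]_d}.
Hypothesis hW : brownian_motion P W.

Local Notation FO t := (g_sigma_algebraType (past_events W t `|` null_events P)).

Lemma measurable_filtration_mono s t d' (T : measurableType d') (f : Omega -> T) :
  s <= t -> measurable_fun setT (f : FO s -> T) ->
  measurable_fun setT (f : FO t -> T).
Proof.
by move=> st mf _ B mB; apply: (filtration_mono st); exact: mf.
Qed.

Lemma measurable_filtration_W s t i : 0 <= s <= t ->
  measurable_fun setT ((fun w => W s w i 0) : FO t -> R).
Proof.
move=> st _ B mB; rewrite setTI; apply: sub_sigma_algebra; left.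
exists s, ((fun v : 'cV[R]_d => v i 0) @^-1` B); split => //.
by rewrite -[X in measurable X]setTI; exact: (measurable_coord i 0).
Qed.

Lemma measurable_filtration_entry t m n (A : Omega -> 'M[R]_(m, n)) i j :
  filtration_measurable P W t A ->
  measurable_fun setT ((fun w => A w i j) : FO t -> R).
Proof.
move=> mA _ B mB; rewrite setTI.
apply: (mA ((fun M : 'M[R]_(m, n) => M i j) @^-1` B)).
by rewrite -[X in measurable X]setTI; exact: (measurable_coord i j).
Qed.

Lemma measurable_sqnorm d' (T : measurableType d') (D : set T) m n
    (A : T -> 'M[R]_(m, n)) :
  (forall i j, measurable_fun D (fun x => A x i j)) ->
  measurable_fun D (fun x => sqnorm (A x)).
Proof.
move=> mA; apply: measurable_sum => i; apply: measurable_sum => j.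
exact: measurable_funX.
Qed.

Variables (H : simple_process P W) (s t : R).
Hypotheses (s0 : 0 <= s) (st : s <= t).

Local Notation tm := (sp_time H).
Local Notation xi := (sp_coef H).

(** Projecting the grid onto [s, t] keeps the indices of [H]: intervals that miss [s, t] become
    degenerate, and the increment of the integral from [s] to [t] is a sum over the same range. *)
Definition clamp_time k := Num.max s (Num.min (tm k) t).

Local Notation u := clamp_time.

Lemma clamp_time_ge k : s <= u k.
Proof. by rewrite le_max lexx. Qed.

Lemma clamp_time_ge0 k : 0 <= u k.
Proof. exact: le_trans s0 (clamp_time_ge k). Qed.

Lemma clamp_time_le k : u k <= t.
Proof. by rewrite ge_max st ge_min lexx orbT. Qed.

Lemma clamp_time_leS k : u k <= u k.+1.
Proof.
by rewrite /clamp_time; apply: Order.TotalTheory.le_max2 => //;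
  apply: Order.TotalTheory.le_min2 => //; exact: sp_time_le.
Qed.

(** Needed for adaptedness: a coefficient is known at time [tm k], which may exceed the clamped time
    only when the clamped interval is degenerate. *)
Lemma clamp_time_adapted k : u k < u k.+1 -> tm k <= u k.
Proof.
rewrite /clamp_time => kk; rewrite le_max le_min lexx/=.
case: (leP (tm k) t) => [_|tk]; first by rewrite orbT.
have tk1 : t <= tm k.+1 by exact: le_trans (ltW tk) (sp_time_le H k).
by move: kk; rewrite !min_r ?ltxx// ltW.
Qed.

(** Turns the difference of two stopped integrals into clamped times: for x <= s both sides vanish,
    and otherwise the maximum with [s] has no effect. *)
Lemma clamp_increment (V : zmodType) (f : R -> V) x :
  f (Num.min x t) - f (Num.min x s) = f (Num.max s (Num.min x t)) - f s.
Proof.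
have [xs|sx] := leP x s.
  by rewrite (min_l (le_trans xs st)) max_l// subrr subrr.
by rewrite max_r// le_min st ltW.
Qed.

Lemma simple_integral_increment w :
  simple_integral H t w - simple_integral H s w =
  \sum_(k < sp_size H) xi k w *m (W (u k.+1) w - W (u k) w).
Proof.
rewrite /simple_integral -sumrB; apply: eq_bigr => k _.
rewrite -mulmxBr; congr (_ *m _).
have E x : W (Num.min x t) w - W (Num.min x s) w =
    W (Num.max s (Num.min x t)) w - W s w := clamp_increment (W ^~ w) x.
have acbd (a b x y : 'cV[R]_d) : a - b - (x - y) = (a - x) - (b - y).
  by rewrite !opprB [y - x]addrC [y - b]addrC addrACA.
by rewrite acbd !E opprB addrA subrK.
Qed.

Variables (c : R) (i : 'I_d).

(** Logarithm of the k-th factor of the exponential supermartingale for coordinate [i]. Only row [i]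
    of the coefficient multiplies the increment, but the compensator takes the whole matrix, because
    that is the quantity compared with theta later. *)
Definition simple_exponent k w : R :=
  \sum_j (c * xi k w i j) * (W (u k.+1) w - W (u k) w) j 0 -
  d%:R ^+ 2 / 2 * (c ^+ 2 * sqnorm (xi k w)) * (u k.+1 - u k).

Lemma simple_exponent_eq0 k w : u k = u k.+1 -> simple_exponent k w = 0.
Proof.
move=> uu; rewrite /simple_exponent -uu !subrr mulr0 subr0 big1// => j _.
by rewrite mxE mulr0.
Qed.

Lemma measurable_simple_exponent k :
  measurable_fun setT (simple_exponent k : FO (u k.+1) -> R).
Proof.
(* On a degenerate interval the coefficient may not yet be known, but the exponent is 0. *)
have [uu|uu] := eqVneq (u k) (u k.+1).
  rewrite (_ : simple_exponent k = cst 0)//.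
  by apply/funext => w; rewrite simple_exponent_eq0.
have {}uu : u k < u k.+1 by rewrite lt_neqAle uu clamp_time_leS.
have mxi j l : measurable_fun setT ((fun w => xi k w j l) : FO (u k.+1) -> R).
  apply: (measurable_filtration_mono (le_trans (clamp_time_adapted uu) (ltW uu))).
  exact: (measurable_filtration_entry j l (@sp_adapted _ _ _ _ _ _ H k)).
apply: measurable_funB.
  apply: measurable_sum => j; apply: measurable_funM; first exact: measurable_funM.
  under [X in measurable_fun _ X]eq_fun do rewrite !mxE.
  apply: measurable_funB; apply: measurable_filtration_W.
    by rewrite clamp_time_ge0 lexx.
  by rewrite clamp_time_ge0 clamp_time_leS.
apply: measurable_funM => //; apply: measurable_funM => //.
by apply: measurable_funM => //; exact: measurable_sqnorm.
Qed.

Lemma measurable_simple_exponential n :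
  measurable_fun setT
    ((fun w => expR (\sum_(k < n) simple_exponent k w)) : FO (u n) -> R).
Proof.
apply: measurableT_comp => //; apply: measurable_sum => k.
apply: (measurable_filtration_mono _ (measurable_simple_exponent (k := k))).
by apply/(nondecreasing_seqP u).1 => //; exact: clamp_time_leS.
Qed.

Lemma integral_simple_exponential_le1 n :
  (\int[P]_w (expR (\sum_(k < n) simple_exponent k w))%:E <= 1)%E.
Proof.
elim: n => [|n IH].
  under eq_integral do rewrite big_ord0 expR0.
  by rewrite integral_cst//= mul1e probability_setT.
under eq_integral do rewrite big_ord_recr/= expRD.
apply: le_trans IH.
have [uu|uu] := eqVneq (u n) (u n.+1).
  by under eq_integral do rewrite simple_exponent_eq0// expR0 mulr1.
have {}uu : u n < u n.+1 by rewrite lt_neqAle uu clamp_time_leS.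
have mxi j l : measurable_fun setT ((fun w => xi n w j l) : FO (u n) -> R).
  apply: (measurable_filtration_mono (clamp_time_adapted uu)).
  exact: (measurable_filtration_entry j l (@sp_adapted _ _ _ _ _ _ H n)).
apply: (integral_exp_increment hW
  (F := fun w => expR (\sum_(k < n) simple_exponent k w)) (a := fun j w => c * xi n w i j)
  (v := fun w => c ^+ 2 * sqnorm (xi n w))) => //.
- exact: leq_ltn_trans (ltn_ord i).
- exact: clamp_time_ge0.
- exact: measurable_simple_exponential.
- by move=> j; exact: measurable_funM.
- by apply: measurable_funM => //; exact: measurable_sqnorm.
(* The squares of row [i] are part of the sum over all entries. *)
move=> w; under eq_bigr do rewrite exprMn.
rewrite -mulr_sumr ler_wpM2l ?sqr_ge0// /sqnorm [leRHS](bigD1 i)//= lerDl.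
by apply: sumr_ge0 => j _; apply: sumr_ge0 => l _; exact: sqr_ge0.
Qed.

Lemma sum_simple_exponent w :
  \sum_(k < sp_size H) simple_exponent k w =
  c * (simple_integral H t w - simple_integral H s w) i 0 -
  d%:R ^+ 2 / 2 * c ^+ 2 *
    \sum_(k < sp_size H) sqnorm (xi k w) * (u k.+1 - u k).
Proof.
rewrite simple_integral_increment summxE !mulr_sumr -sumrB.
apply: eq_bigr => k _; rewrite /simple_exponent; congr (_ - _); last by ring.
by rewrite mxE mulr_sumr; apply: eq_bigr => j _; rewrite mulrA.
Qed.
End simple_exponential.

(** Entrywise, the right side minus the left side is the square of a - 2 b. This is the source of
    the factor 2 in front of B. *)
Lemma sqnorm_le2 {R : realType} m n (A B : 'M[R]_(m, n)) :
  sqnorm A <= 2 * sqnorm (A - B) + 2 * sqnorm B.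
Proof.
rewrite /sqnorm !mulr_sumr -big_split/=; apply: ler_sum => i _.
rewrite !mulr_sumr -big_split/=; apply: ler_sum => j _.
rewrite !mxE -subr_ge0.
rewrite [leRHS](_ : _ = (A i j - 2 * B i j) ^+ 2); last by ring.
exact: sqr_ge0.
Qed.

(** * Quadratic variation of a simple process against its L^2 error *)

Section quadratic_variation.
Context {R : realType} {d : nat} {dO : measure_display}
  {Omega : measurableType dO} {P : probability Omega R}
  {W : R -> Omega -> 'cV[R]_d}.

Local Notation mu := (@lebesgue_measure R).

Variables (H : simple_process P W) (s t : R).
Hypotheses (s0 : 0 <= s) (st : s <= t).

Local Notation tm := (sp_time H).
Local Notation xi := (sp_coef H).
Local Notation u := (clamp_time H s t).

Lemma sp_time_mono : {homo tm : j k / (j <= k)%N >-> j <= k}.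
Proof. by apply/nondecreasing_seqP => k; exact: sp_time_le. Qed.

(** A nonempty clamped interval lies inside the original one, and the original intervals are
    pairwise disjoint, so a single indicator survives. *)
Lemma simple_valueE k v w : (k < sp_size H)%N -> u k < v <= u k.+1 ->
  simple_value H v w = xi k w.
Proof.
move=> ksz /andP[kv vk]; have uu := lt_le_trans kv vk.
have tv : tm k < v := le_lt_trans (clamp_time_adapted uu) kv.
have vt : v <= tm k.+1.
  move: vk; rewrite /clamp_time le_max => /orP[vs|].
    by have := lt_le_trans kv vs; rewrite ltNge clamp_time_ge.
  by rewrite le_min => /andP[].
rewrite /simple_value (bigD1 (Ordinal ksz))//= indicE mem_set; last first.
  by rewrite /= in_itv/= tv.
rewrite scale1r big1 ?addr0// => j jk.
rewrite indicE memNset ?scale0r//= in_itv/= => /andP[jv vj].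
have /negP := jk; apply; apply/eqP/val_inj => /=.
apply/eqP; rewrite eqn_leq; apply/andP; split; rewrite leqNgt; apply/negP => jk'.
- by have := sp_time_mono jk'; rewrite leNgt (lt_le_trans jv vt).
- by have := sp_time_mono jk'; rewrite leNgt (lt_le_trans tv vj).
Qed.

Variables (theta : R -> Omega -> 'M[R]_d) (B : R).
Hypothesis mtheta : forall i j,
  measurable_fun ((`[0, +oo[ : set (measurableTypeR R)) `*` [set: Omega])
    (fun p : measurableTypeR R * Omega => theta p.1 p.2 i j).
Hypothesis thetaB : forall v w, 0 <= v -> sqnorm (theta v w) <= B.
Hypothesis mxi : forall k i j, measurable_fun setT (fun w => xi k w i j).

Let err (p : measurableTypeR R * Omega) : \bar R :=
  (sqnorm (simple_value H p.1 p.2 - theta p.1 p.2))%:E.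

Let measurable_err : measurable_fun
  ((`[0, +oo[ : set (measurableTypeR R)) `*` [set: Omega]) err.
Proof.
apply/measurable_EFinP; apply: measurable_sqnorm => i j.
under [X in measurable_fun _ X]eq_fun do rewrite !mxE summxE.
apply: measurable_funB => //; apply: measurable_funTS.
apply: measurable_sum => k.
under [X in measurable_fun _ X]eq_fun do rewrite !mxE.
apply: measurable_funM.
  by apply: measurableT_comp => //; exact: measurable_indic.
by apply: (measurableT_comp (mxi k i j)); exact: measurable_snd.
Qed.

(** Extension by 0 outside [0, t] gives a function on the whole product space, so that measurability
    of its partial integrals follows from Tonelli. *)
Let errT := err \_ ((`[0, t] : set (measurableTypeR R)) `*` [set: Omega]).

Let measurable_errT : measurable_fun setT errT.
Proof.
apply/(measurable_restrictT _ _).1; first exact: measurableX.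
apply: measurable_funS measurable_err => //; first exact: measurableX.
by move=> [v w] [/=]; rewrite !in_itv/= => /andP[-> _].
Qed.

Let errTE w : (\int[mu]_(v in `[0%R, t]) err (v, w) = \int[mu]_v errT (v, w))%E.
Proof.
rewrite integral_mkcond; apply: eq_integral => v _.
rewrite /errT !patchE; congr (if _ then _ else _).
by apply/idP/idP; rewrite !inE => -[].
Qed.

Lemma measurable_simple_error :
  measurable_fun setT (fun w => \int[mu]_(v in `[0%R, t])
    (sqnorm (simple_value H v w - theta v w))%:E)%E.
Proof.
rewrite (_ : (fun _ => _) = fubini_G mu errT); last first.
  by apply/funext => w; rewrite /fubini_G -errTE.
apply: measurable_fun_fubini_tonelli_G => // p.
by rewrite /errT patchE; case: ifP => // _; rewrite lee_fin sqnorm_ge0.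
Qed.

(** The sum is the integral of |H|^2 over the clamped intervals, where [H] is constant, and there
    |H|^2 / 2 <= |H - theta|^2 + B. The estimate holds for every [w], in the extended reals since
    the error integral may be infinite. *)
Lemma simple_quadratic_variation_le w :
  ((2^-1 * \sum_(k < sp_size H) sqnorm (xi k w) * (u k.+1 - u k))%:E <=
   \int[mu]_(v in `[0%R, t]) (sqnorm (simple_value H v w - theta v w))%:E +
   (B * (t - s))%:E)%E.
Proof.
pose g v := (sqnorm (simple_value H v w - theta v w))%:E.
have mg : measurable_fun (`[0, t] : set (measurableTypeR R)) g.
  apply/(measurable_restrictT _ _).2 => //.
  rewrite (_ : _ \_ _ = fun v => errT (v, w)).
    by apply: (measurableT_comp measurable_errT); exact: measurable_pair2.
  apply/funext => v; rewrite /errT !patchE; congr (if _ then _ else _).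
  by apply/idP/idP; rewrite !inE => -[].
have g0 v : (0 <= g v)%E by rewrite lee_fin sqnorm_ge0.
have B0 : 0 <= B := le_trans (sqnorm_ge0 _) (thetaB w (lexx 0)).
have mgI k : measurable_fun (`]u 0, u k] : set (measurableTypeR R)) g.
  apply: measurable_funS mg => // v; rewrite /= !in_itv/= => /andP[+ vk].
  move=> /ltW/(le_trans (clamp_time_ge0 H t s0 0)) ->/=.
  exact: le_trans vk (clamp_time_le H st k).
have u_mono := (nondecreasing_seqP u).1 (clamp_time_leS H s t).
have step n : (n <= sp_size H)%N ->
  ((2^-1 * \sum_(k < n) sqnorm (xi k w) * (u k.+1 - u k))%:E <=
   \int[mu]_(v in `]u 0, u n]) g v + (B * (u n - u 0))%:E)%E.
  elim: n => [_|n IH nsz].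
    by rewrite big_ord0 mulr0 subrr mulr0 adde0 integral_ge0.
  have un := clamp_time_leS H s t n.
  rewrite big_ord_recr/= mulrDr EFinD.
  have -> : (`]u 0, u n.+1] = `]u 0, u n] `|` `]u n, u n.+1])%classic.
    by rewrite -itv_bndbnd_setU// ?bnd_simp// u_mono.
  rewrite ge0_integral_setU//=; last 2 first.
  - rewrite -itv_bndbnd_setU// ?bnd_simp ?u_mono//.
  - apply/disj_setPS => v [/=]; rewrite !in_itv/= => /andP[_ vn] /andP[nv _].
    by move: vn; rewrite leNgt nv.
  have -> : B * (u n.+1 - u 0) = B * (u n - u 0) + B * (u n.+1 - u n) by ring.
  rewrite EFinD addeACA; apply: leeD; first exact/IH/ltnW.
  have muI : mu `]u n, u n.+1]%classic = (u n.+1 - u n)%:E.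
    rewrite lebesgue_measure_itv/= lte_fin; case: ltP => // un'.
    have -> : u n.+1 = u n by apply/le_anti; rewrite un un'.
    by rewrite subrr.
  have mgn : measurable_fun (`]u n, u n.+1] : set (measurableTypeR R)) g.
    apply: measurable_funS (mgI n.+1) => // v; rewrite /= !in_itv/=.
    by move=> /andP[nv ->]; rewrite (le_lt_trans _ nv)// u_mono.
  (* The n-th summand is the integral of a constant, bounded pointwise through [sqnorm_le2]. *)
  apply: (@le_trans _ _ (\int[mu]_(v in `]u n, u n.+1]) (g v + B%:E))%E).
    rewrite -[X in X%:E](_ : (2^-1 * sqnorm (xi n w)) * (u n.+1 - u n) = _);
      last by ring.
    rewrite EFinM -muI -integral_cst//.
    apply: ge0_le_integral => //=.
    - by move=> v _; rewrite lee_fin mulr_ge0 ?sqnorm_ge0.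
    - exact: emeasurable_funD.
    move=> v; rewrite in_itv/= => vn.
    have v0 : 0 <= v by rewrite (le_trans (clamp_time_ge0 H t s0 n))// ltW; case/andP: vn.
    rewrite /g (simple_valueE w nsz vn) -EFinD lee_fin.
    have := sqnorm_le2 (xi n w) (theta v w); have := thetaB w v0; lra.
  rewrite ge0_integralD//=.
  by rewrite integral_cst// EFinM -muI.
apply: (le_trans (step _ (leqnn _))).
apply: leeD.
- apply: ge0_subset_integral => //= v; rewrite /= !in_itv/= => /andP[/ltW uv vu].
  rewrite (le_trans (clamp_time_ge0 H t s0 0) uv)/=.
  exact: le_trans vu (clamp_time_le H st _).
- rewrite lee_fin ler_wpM2l// lerB//; [exact: clamp_time_le|exact: clamp_time_ge].
Qed.
End quadratic_variation.

(** * Tails of increments of Ito integrals *)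

Lemma ge0_markov {R : realType} d (T : measurableType d)
    (P : probability T R) (f : T -> \bar R) (a : R) :
  measurable_fun setT f -> (forall x, 0 <= f x)%E -> 0 < a ->
  (P [set x | a%:E <= f x] <= (a^-1)%:E * \int[P]_x f x)%E.
Proof.
move=> mf f0 a0; rewrite lee_pdivlMl//.
have := le_integral_abse P measurableT mf a0.
under eq_integral do rewrite gee0_abs//.
rewrite setTI; suff -> : [set x | a%:E <= `|f x|]%E = [set x | a%:E <= f x]%E by [].
by apply/funext => x/=; rewrite gee0_abs.
Qed.

Lemma ge0_measurable_ge {R : realType} d (T : measurableType d)
    (f : T -> \bar R) (a : R) :
  measurable_fun setT f -> measurable [set x | a%:E <= f x]%E.
Proof.
by move=> mf; rewrite -[X in measurable X]setTI; exact: emeasurable_fun_c_infty.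
Qed.

Lemma sqr_le_sqnorm {R : realType} m n (A : 'M[R]_(m, n)) i j :
  A i j ^+ 2 <= sqnorm A.
Proof.
rewrite /sqnorm (bigD1 i)//= (bigD1 j)//= -addrA lerDl addr_ge0//.
  by apply: sumr_ge0 => k _; exact: sqr_ge0.
by apply: sumr_ge0 => k _; apply: sumr_ge0 => l _; exact: sqr_ge0.
Qed.

Section ito_tail.
Context {R : realType} {d : nat} {dO : measure_display}
  {Omega : measurableType dO} {P : probability Omega R}
  {W : R -> Omega -> 'cV[R]_d}.
Hypothesis hW : brownian_motion P W.

Local Notation mu := (@lebesgue_measure R).

Lemma measurable_sp_coef (H : simple_process P W) k i j :
  measurable_fun setT (fun w => sp_coef H k w i j).
Proof.
apply: (measurable_filtration_fun hW (t := sp_time H k)).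
exact: (measurable_filtration_entry i j (@sp_adapted _ _ _ _ _ _ H k)).
Qed.

Lemma sp_time_ge0 (H : simple_process P W) k : 0 <= sp_time H k.
Proof. by apply: le_trans (sp_time0 H) _; exact: sp_time_mono. Qed.

Lemma measurable_simple_integral (H : simple_process P W) t i : 0 <= t ->
  measurable_fun setT (fun w => simple_integral H t w i 0).
Proof.
move=> t0; under [X in measurable_fun _ X]eq_fun do rewrite summxE.
apply: measurable_sum => k.
under [X in measurable_fun _ X]eq_fun do rewrite mxE.
apply: measurable_sum => j; apply: measurable_funM.
  exact: measurable_sp_coef.
by apply: (measurable_increment hW); rewrite le_min sp_time_ge0.
Qed.

Variables (theta : R -> Omega -> 'M[R]_d) (X : Omega -> cpath R d) (B : R).
Hypothesis mtheta : forall i j,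
  measurable_fun ((`[0, +oo[ : set (measurableTypeR R)) `*` [set: Omega])
    (fun p : measurableTypeR R * Omega => theta p.1 p.2 i j).
Hypothesis thetaB : forall v w, 0 <= v -> sqnorm (theta v w) <= B.
Hypothesis mX : forall t i, measurable_fun setT (fun w => X w t i 0).

(** If the errors at [t] and [s] cost at most 1/4 each and the quadratic variation error at most
    1/2, the exponent [Y] is at least x - 1 - K; these three costs make up the 1 in the bound. Each
    exceptional event, and the event that exp(Y) is large, is handled by Markov's inequality. *)
Lemma simple_integral_tail (H : simple_process P W) s t c i x :
  0 <= s -> s <= t ->
  (P [set w | (x <= c * (X w t - X w s) i 0)%R] <=
   (expR (d%:R ^+ 2 * c ^+ 2 * (B * (t - s)) + 1 - x))%:E +
   ((16 * c ^+ 2)%:E * \int[P]_w (sqnorm (simple_integral H t w - X w t))%:E +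
   ((16 * c ^+ 2)%:E * \int[P]_w (sqnorm (simple_integral H s w - X w s))%:E +
   (2 * (d%:R ^+ 2 * c ^+ 2))%:E *
     \int[P]_w \int[mu]_(v in `[0%R, t])
       (sqnorm (simple_value H v w - theta v w))%:E)))%E.
Proof.
move=> s0 st; have t0 := le_trans s0 st.
pose K := d%:R ^+ 2 * c ^+ 2 * (B * (t - s)).
pose A w := \sum_(k < sp_size H) sqnorm (sp_coef H k w) *
  (clamp_time H s t k.+1 - clamp_time H s t k).
pose Y w := c * (simple_integral H t w - simple_integral H s w) i 0 -
  d%:R ^+ 2 / 2 * c ^+ 2 * A w.
pose D w := (\int[mu]_(v in `[0%R, t])
       (sqnorm (simple_value H v w - theta v w))%:E)%E.
pose E1 := [set w | (expR (x - 1 - K))%:E <= (expR (Y w))%:E]%E.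
pose G r w := ((c ^+ 2)%:E * (sqnorm (simple_integral H r w - X w r))%:E)%E.
(* The threshold is the square of 1/4, since [G] is a squared error. *)
pose E2 r := [set w | (16^-1)%:E <= G r w]%E.
pose E3 := [set w | (2^-1)%:E <= (d%:R ^+ 2 * c ^+ 2)%:E * D w]%E.
have mD : measurable_fun setT D.
  by apply: measurable_simple_error => //; exact: measurable_sp_coef.
have D0 w : (0 <= D w)%E.
  by apply: integral_ge0 => v _; rewrite lee_fin sqnorm_ge0.
have mdiff r j l : 0 <= r ->
    measurable_fun setT (fun w => (simple_integral H r w - X w r) j l).
  move=> r0; rewrite (ord1 l).
  under [X in measurable_fun _ X]eq_fun do rewrite !mxE.
  by apply: measurable_funB => //; exact: measurable_simple_integral.
have mI r : 0 <= r -> measurable_fun setT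
    (fun w => (sqnorm (simple_integral H r w - X w r))%:E).
  move=> r0; apply/measurable_EFinP; apply: measurable_sqnorm => j l.
  exact: mdiff.
have mG r : 0 <= r -> measurable_fun setT (G r).
  by move=> r0; apply: measurable_funeM; exact: mI.
have mY : measurable_fun setT (fun w => (expR (Y w))%:E).
  have := measurable_filtration_fun hW
    (@measurable_simple_exponential _ _ _ _ _ _ H s t s0 c i (sp_size H)).
  move/measurable_EFinP; congr measurable_fun; apply/funext => w /=.
  by rewrite sum_simple_exponent.
have sub : [set w | x <= c * (X w t - X w s) i 0] `<=`
    E1 `|` (E2 t `|` (E2 s `|` E3)).
  move=> w /= xw.
  have [?|n1] := pselect (E1 w); first by left.
  have [?|n2] := pselect (E2 t w); first by right; left.
  have [?|n3] := pselect (E2 s w); first by right; right; left.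
  have [?|n4] := pselect (E3 w); first by right; right; right.
  exfalso; apply: n1; rewrite /E1/= lee_fin ler_expR.
  have /negP := n4; rewrite -ltNge => D2.
  have dc0 : 0 <= d%:R ^+ 2 * c ^+ 2 by rewrite mulr_ge0 ?sqr_ge0.
  have AK : d%:R ^+ 2 / 2 * c ^+ 2 * A w <= 2^-1 + K.
    have := simple_quadratic_variation_le s0 st mtheta thetaB
      (@measurable_sp_coef H) w.
    rewrite -/(A w) -/(D w) => AD.
    rewrite [leLHS](_ : _ = (d%:R ^+ 2 * c ^+ 2) * (2^-1 * A w)); last by ring.
    rewrite -lee_fin EFinM; apply: (@le_trans _ _
      ((d%:R ^+ 2 * c ^+ 2)%:E * (D w + (B * (t - s))%:E))%E).
      by rewrite lee_wpmul2l.
    rewrite muleDr ?fin_num_adde_defl//.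
    by rewrite -EFinM EFinD leeD// ltW.
  have Gr r : ~ E2 r w -> `|c * (simple_integral H r w - X w r) i 0| < 4^-1.
    move=> /negP; rewrite -ltNge /G -EFinM lte_fin => Gr.
    rewrite -(@ltr_pXn2r _ 2)// ?nnegrE// real_normK ?num_real// exprMn.
    apply: (@le_lt_trans _ _ (c ^+ 2 * sqnorm (simple_integral H r w - X w r))).
      by rewrite ler_wpM2l ?sqr_ge0// sqr_le_sqnorm.
    by apply: (lt_le_trans Gr); lra.
  have := Gr _ n2; have := Gr _ n3; move: xw AK; rewrite /Y !mxE.
  rewrite !ltr_norml => xw AK /andP[s1 s2] /andP[t1 t2].
  by move: xw AK s1 s2 t1 t2; rewrite !mulrDr !mulrN; lra.
have mE1 : measurable E1 by exact: ge0_measurable_ge.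
have mE2 r : 0 <= r -> measurable (E2 r) by move=> r0; exact/ge0_measurable_ge/mG.
have mE3 : measurable E3 by apply: ge0_measurable_ge; exact: measurable_funeM.
apply: (@le_trans _ _ (P (E1 `|` (E2 t `|` (E2 s `|` E3))))).
  apply: le_measure => //; rewrite inE.
    rewrite -[X in measurable X]setTI.
    have mXX : measurable_fun setT (fun w => c * (X w t - X w s) i 0).
      apply: measurable_funM => //.
      under [X in measurable_fun _ X]eq_fun do rewrite !mxE.
      exact: measurable_funB.
    by have := mXX measurableT _ (measurable_itv `[x, +oo[); rewrite set_itvcy.
  by apply: measurableU => //; apply: measurableU; [exact: mE2|];
    apply: measurableU => //; exact: mE2.
apply: (le_trans (measureU2 _ _ _)) => //.
  by apply: measurableU; [exact: mE2|]; apply: measurableU => //; exact: mE2.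
apply: leeD.
  have Y0 w : (0 <= (expR (Y w))%:E)%E by rewrite lee_fin expR_ge0.
  apply: (le_trans (ge0_markov P mY Y0 (expR_gt0 (x - 1 - K)))).
  rewrite -[leRHS]mule1 -expRN opprB opprB addrA; apply: lee_pmul => //.
  - by apply: integral_ge0 => w _; rewrite lee_fin expR_ge0.
  apply: le_trans (integral_simple_exponential_le1 hW H t s0 c i (sp_size H)).
  rewrite le_eqVlt; apply/orP; left; apply/eqP; apply: eq_integral => w _.
  by rewrite sum_simple_exponent.
apply: (le_trans (measureU2 _ _ _)) => //; first exact: mE2.
  by apply: measurableU => //; exact: mE2.
have PE2 r : 0 <= r -> (P (E2 r) <= (16 * c ^+ 2)%:E * 
    \int[P]_w (sqnorm (simple_integral H r w - X w r))%:E)%E.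
  move=> r0; apply: (le_trans (ge0_markov P (mG _ r0) _ _)) => //.
    by move=> w; rewrite mule_ge0// lee_fin ?sqr_ge0 ?sqnorm_ge0.
  rewrite invrK ge0_integralZl ?lee_fin ?sqr_ge0//.
    by rewrite muleA -EFinM.
    exact: mI.
  by move=> w _; rewrite lee_fin sqnorm_ge0.
apply: leeD; first exact: PE2.
apply: (le_trans (measureU2 _ _ _)) => //; first exact: mE2.
apply: leeD; first exact: PE2.
have dc0 : (0 <= (d%:R ^+ 2 * c ^+ 2)%:E :> \bar R)%E.
  by rewrite lee_fin mulr_ge0 ?sqr_ge0.
apply: (le_trans (ge0_markov P (measurable_funeM _ mD) _ _)) => //.
  by move=> w; rewrite mule_ge0.
by rewrite invrK ge0_integralZl// muleA -EFinM.
Qed.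

Lemma ito_tail s t c i x : is_ito_integral P W theta X -> 0 <= s -> s <= t ->
  (P [set w | (x <= c * (X w t - X w s) i 0)%R] <=
   (expR (d%:R ^+ 2 * c ^+ 2 * (B * (t - s)) + 1 - x))%:E)%E.
Proof.
move=> [H [Htheta HX]] s0 st; have t0 := le_trans s0 st.
set e := (expR _)%:E.
pose r n : \bar R :=
   ((16 * c ^+ 2)%:E *
     \int[P]_w (sqnorm (simple_integral (H n) t w - X w t))%:E +
   ((16 * c ^+ 2)%:E *
     \int[P]_w (sqnorm (simple_integral (H n) s w - X w s))%:E +
   (2 * (d%:R ^+ 2 * c ^+ 2))%:E *
     \int[P]_w \int[mu]_(v in `[0%R, t])
       (sqnorm (simple_value (H n) v w - theta v w))%:E))%E.
have r0 : (e + r n)%E @[n --> \oo] --> (e + 0)%E.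
  apply: cvgeD; [by rewrite fin_num_adde_defl|exact: cvg_cst|].
  rewrite -[X in _ --> X](_ : (16 * c ^+ 2)%:E * 0 + ((16 * c ^+ 2)%:E * 0 +
    (2 * (d%:R ^+ 2 * c ^+ 2))%:E * 0) = 0)%E; last by rewrite !mule0 !adde0.
  apply: cvgeD; [by rewrite !mule0|exact: cvgeZl (HX _ t0)|].
  apply: cvgeD; [by rewrite !mule0|exact: cvgeZl (HX _ s0)|].
  exact: cvgeZl (Htheta _ t0).
rewrite -[leRHS]adde0 -(cvg_lim _ r0)//; apply: lime_ge.
  by apply/cvg_ex; exists (e + 0)%E.
by apply: nearW => n; exact: simple_integral_tail.
Qed.
End ito_tail.

(** * Compact sets of paths *)

(** The image filter clusters at some l in a segment. An ultrafilter contains each set |f - l| < e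
    or its complement, and the complement would contradict clustering. *)
Lemma ultra_bounded_cvg {R : realType} {T : Type} (F : set_system T)
    (f : T -> R) (M : R) : UltraFilter F -> (\forall x \near F, `|f x| <= M) ->
  exists l : R, f x @[x --> F] --> l.
Proof.
move=> UF FM.
have /(_ (f @ F)) := @segment_compact R (- M) M.
have GM : (f @ F) `[- M, M]%classic.
  by apply: filterS FM => x; rewrite /= in_itv/= ler_norml.
case=> // l [_ lF]; exists l; apply/cvgrPdist_lt => e e0.
have [//|nF] := in_ultra_setVsetC [set x | `|l - f x| < e] UF.
have [y [/= yl]] := lF [set y | ~ `|l - y| < e] _ nF (nbhsx_ballx l _ e0).
by move=> /yl.
Qed.

Section path_space.
Context {R : realType} {d : nat}.
Implicit Types a b : cpath R d.

Lemma coord_le_enorm m n (A : 'M[R]_(m, n)) i j : `|A i j| <= enorm A.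
Proof.
rewrite -(@ler_pXn2r _ 2)// ?nnegrE ?enorm_ge0// sqr_enorm real_normK ?num_real//.
exact: sqr_le_sqnorm.
Qed.

(** The sharp factor is the square root of m n; the larger m n avoids roots and suffices here. *)
Lemma enorm_le_coord m n (A : 'M[R]_(m, n)) (x : R) : 0 <= x ->
  (forall i j, `|A i j| <= x) -> enorm A <= (m * n)%:R * x.
Proof.
move=> x0 Ax.
have mnx : 0 <= (m * n)%:R * x by rewrite mulr_ge0.
rewrite -(@ler_pXn2r _ 2)// ?nnegrE ?enorm_ge0// sqr_enorm.
apply: (@le_trans _ _ (\sum_(i < m) \sum_(j < n) x ^+ 2)).
  apply: ler_sum => i _; apply: ler_sum => j _.
  by rewrite -[leLHS]real_normK ?num_real// ler_pXn2r// nnegrE.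
rewrite !sumr_const !card_ord -mulrnA -[leLHS]mulr_natl [(n * m)%N]mulnC exprMn.
rewrite ler_wpM2r ?sqr_ge0// -natrX ler_nat.
by case: (m * n)%N => // k; rewrite -mulnn leq_pmulr.
Qed.

(** A single term of the series is at most [rho], and e <= 1 ensures that the truncation at 1 in
    that term is not the active bound. *)
Lemma coord_le_rho a b t e i (k : nat) : 0 <= t <= k.+1%:R -> e <= 1 ->
  rho a b < 2^-1 ^+ k.+1 * e -> `|a t i 0 - b t i 0| < e.
Proof.
move=> tk e1 abe.
have : rho_term a b k < 2^-1 ^+ k.+1 * e.
  apply: le_lt_trans abe.
  apply: (@le_trans _ _ (series (rho_term a b) k.+1)).
    by rewrite seriesEnat/= big_nat_recr//= lerDr sumr_ge0// => j _;
      exact: rho_term_ge0.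
  apply: nondecreasing_cvgn_le; last exact: is_cvg_rho.
  by apply/nondecreasing_seqP => j; rewrite !seriesEnat/= big_nat_recr//=
    lerDl rho_term_ge0.
rewrite /rho_term ltr_pM2l ?exprn_gt0// gt_min [1 < e]ltNge e1 orbF.
apply: le_lt_trans; apply: le_trans (max_dist_ub a b tk).
by have := coord_le_enorm (a t - b t) i 0; rewrite !mxE.
Qed.

Lemma rho_le a b (N : nat) e : 0 <= e -> max_dist N%:R a b <= e ->
  rho a b <= e + 2^-1 ^+ N.
Proof.
move=> e0 abe; apply: limr_le; first exact: is_cvg_rho.
apply: nearW => n.
(* Invariant of the partial sums: the first N terms are weighted by [e], with total weight below 1;
   the maximum stays 0 up to n = N and then collects the geometric weights of the remaining
   terms. *)
suff : series (rho_term a b) n <=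
    e * (1 - 2^-1 ^+ n) + Num.max 0 (2^-1 ^+ N - 2^-1 ^+ n).
  move=> /le_trans; apply; rewrite lerD//.
    by rewrite ler_piMr// lerBlDr lerDl exprn_ge0.
  by rewrite ge_max exprn_ge0//= lerBlDr lerDl exprn_ge0.
elim: n => [|n IH].
  by rewrite /series/= big_geq// expr0 subrr mulr0 add0r le_max lexx.
rewrite seriesEnat/= big_nat_recr//= -[X in X + _]/(series (rho_term a b) n).
have -> : e * (1 - 2^-1 ^+ n.+1) = e * (1 - 2^-1 ^+ n) + 2^-1 ^+ n.+1 * e.
  by rewrite !exprS; field.
have h0 : 0 <= 2^-1 ^+ n.+1 :> R by rewrite exprn_ge0.
have hS : 2^-1 ^+ n = 2 * 2^-1 ^+ n.+1 :> R.
  by rewrite exprS mulrA divff// mul1r.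
have [nN|Nn] := ltnP n N.
  have tn : rho_term a b n <= 2^-1 ^+ n.+1 * e.
    rewrite /rho_term ler_wpM2l// ge_min; apply/orP; left.
    apply: le_trans abe; apply: max_dist_le => // t /andP[t0 tn].
    by apply: max_dist_ub; rewrite t0 (le_trans tn)// ler_nat.
  have : Num.max 0 (2^-1 ^+ N - 2^-1 ^+ n) <=
      Num.max 0 (2^-1 ^+ N - 2^-1 ^+ n.+1) :> R.
    rewrite ge_max !le_max lexx/=; apply/orP; right.
    by rewrite lerD2l lerN2 hS; lra.
  by move: IH tn; lra.
have tn := rho_term_le a b n.
have NnR : 2^-1 ^+ n <= 2^-1 ^+ N :> R.
  by apply: ler_wiXn2l => //; lra.
move: IH; rewrite !max_r; last 2 first.
- by rewrite subr_ge0 (le_trans _ NnR)// hS; lra.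
- by rewrite subr_ge0.
have := mulr_ge0 h0 e0; move: tn; rewrite hS; lra.
Qed.

Lemma coord_path_continuous t i : continuous (fun a : cpath R d => a t i 0).
Proof.
have [t0|t0] := leP t 0.
  rewrite (_ : (fun _ => _) = cst 0); first exact: cst_continuous.
  by apply/funext => a; rewrite cpath_eq0// mxE.
move=> a; apply/(@cvgrPdist_lt _ _ _ (nbhs a)) => e e0.
pose k := Num.truncn t.
have tk : 0 <= t <= k.+1%:R by rewrite (ltW t0) ltW// truncnS_gt.
pose e' := Num.min e 1.
have e'0 : 0 < e' by rewrite lt_min e0/=.
apply: filterS (nbhsx_ballx a (2^-1 ^+ k.+1 * e') _).
  move=> b; rewrite ballEmdist/= => ab.
  have : `|a t i 0 - b t i 0| < e'.
    by apply: coord_le_rho ab; rewrite // ge_min lexx orbT.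
  by rewrite lt_min => /andP[].
by rewrite mulr_gt0// exprn_gt0.
Qed.
End path_space.

Section compactness.
Context {R : realType} {d : nat}.
Implicit Types (a b : cpath R d) (A : set (cpath R d)).

Definition equicontinuous_on_bounded A := forall T e : R, 0 < T -> 0 < e ->
  exists2 delta, 0 < delta & forall a, A a -> forall i s t,
    0 <= s <= T -> 0 <= t <= T -> `|s - t| <= delta ->
    `|a s i 0 - a t i 0| <= e.

(** Every path starts at 0, and each step of length at most [delta] on the way to [t] changes a
    coordinate by at most 1, so the number of steps is a bound. *)
Lemma equicontinuous_coord_bounded A t i : equicontinuous_on_bounded A ->
  exists M, forall a, A a -> `|a t i 0| <= M.
Proof.
move=> eA; have [t0|t0] := leP t 0.
  by exists 0 => a _; rewrite cpath_eq0// mxE normr0.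
have [delta d0 Ad] := eA t 1 t0 ltr01.
exists (Num.truncn (t / delta)).+1%:R => a Aa.
suff H n s : 0 <= s <= t -> s <= n%:R * delta -> `|a s i 0| <= n%:R.
  apply: H; first by rewrite (ltW t0) lexx.
  by rewrite -ler_pdivrMr// ltW// truncnS_gt.
elim: n s => [|n IH] s /andP[s0 st] sn.
  by rewrite cpath_eq0 ?mxE ?normr0//; move: sn; rewrite mul0r.
have [sd|ds] := leP s delta.
  have := Ad _ Aa i s 0; rewrite s0 st lexx (ltW t0) subr0 ger0_norm// sd.
  rewrite [a 0]cpath_eq0// mxE subr0 => /(_ isT isT isT) h.
  by rewrite (le_trans h)// ler1n.
have sd0 : 0 <= s - delta by rewrite subr_ge0 ltW.
have sdt : s - delta <= t by lra.
have := Ad _ Aa i s (s - delta); rewrite s0 st sd0 sdt subKr gtr0_norm//.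
move=> /(_ isT isT (lexx _)) h.
have := IH (s - delta); rewrite sd0 sdt => /(_ isT).
have -> : s - delta <= n%:R * delta by move: sn; rewrite -natr1; lra.
move=> /(_ isT) h'; rewrite -natr1 -(subrK (a (s - delta) i 0) (a s i 0)).
by rewrite (le_trans (ler_normD _ _))// addrC lerD.
Qed.

(** Arzela-Ascoli with ultrafilters: an ultrafilter on [A] converges at each time and coordinate,
    the limit inherits the common modulus, and convergence on a finite grid together with the
    modulus gives uniform convergence on bounded intervals. *)
Lemma closed_equicontinuous_compact A : closed A -> equicontinuous_on_bounded A ->
  compact A.
Proof.
move=> cA eA; rewrite compact_ultra => F UF FA.
have lim t i : exists l : R, (fun a : cpath R d => a t i 0) @ F --> l.
  have [M AM] := equicontinuous_coord_bounded t i eA.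
  by apply: (@ultra_bounded_cvg _ _ _ _ M UF); exact: filterS FA.
have {lim} [f fP] : exists f : R -> 'I_d -> R,
    forall t i, (fun a : cpath R d => a t i 0) @ F --> f t i.
  have [f fP] := choice (fun p : R * 'I_d => lim p.1 p.2).
  by exists (fun t i => f (t, i)) => t i; exact: (fP (t, i)).
have near_f t i e : 0 < e -> F [set a : cpath R d | `|f t i - a t i 0| <= e].
  by move=> e0; move/cvgrPdist_le : (fP t i); apply.
have f0 t i : t <= 0 -> f t i = 0.
  move=> t0; apply/eqP; rewrite -normr_le0; apply/ler_addgt0Pr => e e0.
  have [a /=] := filter_ex (near_f t i e e0).
  by rewrite cpath_eq0// mxE subr0 add0r.
have fmod T e : 0 < T -> 0 < e -> exists2 delta, 0 < delta &
    forall i s t, 0 <= s <= T -> 0 <= t <= T -> `|s - t| <= delta ->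
    `|f s i - f t i| <= e.
  move=> T0 e0; have [delta d0 Ad] := eA T e T0 e0.
  exists delta => // i s t sT tT st; apply/ler_addgt0Pr => r r0.
  have r20 : 0 < r / 2 by rewrite divr_gt0.
  have [a [[/= sa ta] Aa]] := filter_ex (filterI (filterI
    (near_f s i _ r20) (near_f t i _ r20)) FA).
  have := Ad _ Aa i s t sT tT st.
  rewrite (_ : f s i - f t i = (f s i - a s i 0) + (a s i 0 - a t i 0) +
     (a t i 0 - f t i)); last by ring.
  move=> h; rewrite distrC in ta.
  have h1 := ler_normD (f s i - a s i 0 + (a s i 0 - a t i 0)) (a t i 0 - f t i).
  have h2 := ler_normD (f s i - a s i 0) (a s i 0 - a t i 0).
  by rewrite (splitr r); lra.
(* The modulus is known only on nonnegative times, while a path is a function on the whole line;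
   replacing [t] by its positive part reconciles the two. *)
have fpos t i : f t i = f (Num.max 0 t) i.
  by have [t0|//] := leP t 0; rewrite !f0.
pose g t : 'cV[R]_d := \col_i f t i.
have cg : continuous g.
  move=> t; apply/cvgrPdist_le => e e0.
  have T0 : 0 < Num.max 0 t + 1 by rewrite ltr_wpDl// le_max lexx.
  have [delta d0 fd] := fmod _ e T0 e0.
  apply: filterS (nbhsx_ballx t (Num.min delta 1) _); last first.
    by rewrite lt_min d0/=.
  move=> s; rewrite /ball/= lt_min => /andP[sd s1].
  rewrite [leLHS]/Num.norm/= mx_normrE; apply/bigmax_leP; split; first exact: ltW.
  move=> [i j] _ /=; rewrite !mxE fpos (fpos s).
  have ts : `|Num.max 0 t - Num.max 0 s| <= `|t - s|.
    have := ler_norm (t - s); have := ler_norm (s - t); rewrite distrC ler_norml.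
    by case: (leP 0 t) => ?; case: (leP 0 s) => ?; lra.
  apply: fd; last exact: (le_trans ts (ltW sd)).
  - by rewrite le_max lexx lerDl ler01.
  - rewrite le_max lexx/=.
    by have := le_lt_trans ts s1; rewrite ltr_norml => /andP[+ _]; lra.
have cg0 t : t <= 0 -> g t = 0.
  by move=> t0; apply/matrixP => i j; rewrite !mxE f0.
pose p := CPath cg cg0.
have Fp : F --> p.
  apply/cvg_ballP => e e0.
  (* The tail of [rho] beyond [N] is at most e/2; uniform distance e/4 on [0, N] then leaves room
     for a strict inequality. *)
  pose N := (Num.truncn (2 / e)).+1.
  have N0 : 0 < N%:R :> R by rewrite ltr0n.
  have Ne : 2^-1 ^+ N <= e / 2.
    rewrite exprVn -[leRHS]invrK lef_pV2 ?posrE ?exprn_gt0 ?invr_gt0 ?divr_gt0//.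
    rewrite invf_div (le_trans (ltW (truncnS_gt _)))// -/N -natrX ler_nat.
    by rewrite ltnW// ltn_expl.
  (* Passing from coordinates to the Euclidean norm costs a factor [d]; [d.+1] covers it and is
     never 0. The thirds serve the modulus of the limit, the grid error and the modulus of [a]. *)
  pose eta := e / 4 / d.+1%:R.
  have eta0 : 0 < eta by rewrite !divr_gt0.
  have eta30 : 0 < eta / 3 by rewrite divr_gt0.
  have [d1 d10 Ad] := eA _ _ N0 eta30.
  have [d2 d20 fd] := fmod _ _ N0 eta30.
  pose delta := Num.min d1 d2.
  have delta0 : 0 < delta by rewrite lt_min d10.
  pose m := (Num.truncn (N%:R / delta)).+1.
  have : F [set a : cpath R d | forall ji : 'I_m * 'I_d,
      `|f (ji.1%:R * delta) ji.2 - a (ji.1%:R * delta) ji.2 0| <= eta / 3].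
    by apply: filter_forall => -[j i] /=; exact: near_f.
  apply: filterS2 FA => a Aa fa; rewrite ballEmdist/=.
  have e40 : 0 <= e / 4 by rewrite ltW// divr_gt0.
  suff /(rho_le e40) : max_dist N%:R p a <= e / 4.
    by rewrite -[mdist p a]/(rho p a); lra.
  apply: max_dist_le => // t /andP[t0 tN].
  apply: (@le_trans _ _ ((d * 1)%:R * eta)).
    apply: enorm_le_coord; first exact: ltW.
    move=> i j; rewrite (ord1 j) !mxE.
    pose k := Num.truncn (t / delta).
    have tk0 : 0 <= t / delta by rewrite divr_ge0// ltW.
    have km : (k < m)%N.
      by rewrite ltnS; apply: le_truncn; rewrite ler_pM2r ?invr_gt0.
    have /andP[kt tk] := truncn_itv tk0.
    have {}kt : k%:R * delta <= t by rewrite -ler_pdivlMr.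
    have {}tk : t < k%:R * delta + delta.
      by move: tk; rewrite ltr_pdivrMr// -natr1 mulrDl mul1r.
    have kd0 : 0 <= k%:R * delta by rewrite mulr_ge0// ltW.
    have kdN : 0 <= k%:R * delta <= N%:R by rewrite kd0 (le_trans kt).
    have tNN : 0 <= t <= N%:R by rewrite t0.
    have tkd : `|t - k%:R * delta| <= delta by rewrite ger0_norm; lra.
    have [dd1 dd2] : delta <= d1 /\ delta <= d2.
      by rewrite /delta !ge_min !lexx orbT.
    have := fa (Ordinal km, i) => /= h1.
    have h2 := Ad _ Aa i _ _ tNN kdN (le_trans tkd dd1).
    have h3 := fd i _ _ tNN kdN (le_trans tkd dd2).
    rewrite (_ : _ - _ = (f t i - f (k%:R * delta) i) +
      (f (k%:R * delta) i - a (k%:R * delta) i 0) -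
      (a t i 0 - a (k%:R * delta) i 0)); last by ring.
    apply: (le_trans (ler_normB _ _)).
    have h4 := ler_normD (f t i - f (k%:R * delta) i)
      (f (k%:R * delta) i - a (k%:R * delta) i 0).
    lra.
  rewrite muln1 /eta mulrCA ler_piMr ?divr_ge0 ?(ltW e0)//.
  by rewrite ler_pdivrMr// mul1r ler_nat.
by exists p; split => //; exact: (closed_cvg _ cA FA).
Qed.
End compactness.

(** * Dyadic increments *)

Section chaining.
Context {R : realType}.
Implicit Types (f : R -> R) (t : R).

Definition dyadic_floor n t : nat := Num.truncn (t * 2 ^+ n).

Lemma dyadic_floor_itv n t : 0 <= t ->
  (dyadic_floor n t)%:R <= t * 2 ^+ n < (dyadic_floor n t)%:R + 1.
Proof. by move=> t0; rewrite natr1; apply: truncn_itv; rewrite mulr_ge0. Qed.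

(** Origin of 4^n: the interval [0, 2^n] holds 2^n * 2^n steps of length 2^-n. *)
Lemma dyadic_floor_lt n m t : 0 <= t < 2 ^+ m -> (m <= n)%N ->
  (dyadic_floor n t < 4 ^ n)%N.
Proof.
move=> /andP[t0 tm] mn; have /andP[+ _] := dyadic_floor_itv n t0.
rewrite -(ltr_nat R) => /le_lt_trans; apply.
have -> : (4 ^ n)%:R = 2 ^+ n * 2 ^+ n :> R by rewrite natrX -exprMn; congr (_ ^+ _); ring.
rewrite ltr_pM2r ?exprn_gt0// (lt_le_trans tm)// ler_weXn2l//.
by rewrite ler1n.
Qed.

Lemma dyadic_floorS n t : 0 <= t ->
  dyadic_floor n.+1 t = (dyadic_floor n t).*2 \/
  dyadic_floor n.+1 t = (dyadic_floor n t).*2.+1.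
Proof.
move=> t0; have /andP[a b] := dyadic_floor_itv n t0.
have /andP[a' b'] := dyadic_floor_itv n.+1 t0.
move: a' b'; rewrite exprS mulrCA => a' b'.
have : ((dyadic_floor n t).*2 < (dyadic_floor n.+1 t).+1)%N.
  by rewrite -(ltr_nat R) -natr1 -mul2n natrM; lra.
have : (dyadic_floor n.+1 t < (dyadic_floor n t).*2.+2)%N.
  by rewrite -(ltr_nat R) -natr1 -natr1 -mul2n natrM; lra.
rewrite !ltnS leq_eqVlt => /orP[/eqP ->|]; first by right.
by rewrite ltnS => h1 h2; left; apply/eqP; rewrite eqn_leq h1.
Qed.

Variables (f : R -> R) (n0 : nat) (r : R).
Hypothesis r_itv : 0 <= r <= 9 / 10.
Hypothesis f_incr : forall n j, (n0 <= n)%N -> (j < 4 ^ n)%N ->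
  `|f (j.+1%:R / 2 ^+ n) - f (j%:R / 2 ^+ n)| <= r ^+ n.

(** One refinement moves the dyadic point by at most one step of the finer level, and r <= 9/10
    gives r^(n+1) <= 9 (r^n - r^(n+1)), so the sum telescopes. *)
Lemma dyadic_chain m k t : (n0 <= m)%N -> 0 <= t < 2 ^+ m ->
  `|f ((dyadic_floor (m + k) t)%:R / 2 ^+ (m + k)) -
    f ((dyadic_floor m t)%:R / 2 ^+ m)| <= 9 * (r ^+ m - r ^+ (m + k)).
Proof.
move=> nm tm; have /andP[t0 _] := tm; have /andP[r0 r1] := r_itv.
elim: k => [|k IH]; first by rewrite addn0 !subrr normr0 mulr0.
rewrite addnS; set n := (m + k)%N in IH *.
have step : `|f ((dyadic_floor n.+1 t)%:R / 2 ^+ n.+1) -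
    f ((dyadic_floor n t)%:R / 2 ^+ n)| <= r ^+ n.+1.
  have -> : (dyadic_floor n t)%:R / 2 ^+ n =
      (dyadic_floor n t).*2%:R / 2 ^+ n.+1 :> R.
    rewrite -mul2n natrM exprS invfM mulrACA divff ?mul1r//.
  case: (dyadic_floorS n t0) => [->|dE].
    by rewrite subrr normr0 exprn_ge0.
  rewrite dE; apply: f_incr; first by rewrite (leq_trans nm)// -addnS leq_addr.
  have := dyadic_floor_lt tm (leq_trans (leq_addr k.+1 m) (leqnn _)).
  by rewrite addnS -/n dE; exact: ltnW.
have rn : r ^+ n.+1 <= 9 / 10 * r ^+ n.
  by rewrite exprS ler_wpM2r// exprn_ge0.
apply: (le_trans (ler_distD (f ((dyadic_floor n t)%:R / 2 ^+ n)) _ _)).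
by move: IH step rn; lra.
Qed.

Hypothesis cf : continuous f.

Lemma dyadic_floor_dist m t : (n0 <= m)%N -> 0 <= t < 2 ^+ m ->
  `|f t - f ((dyadic_floor m t)%:R / 2 ^+ m)| <= 9 * r ^+ m.
Proof.
move=> nm tm; have /andP[t0 _] := tm; have /andP[r0 r1] := r_itv.
apply/ler_addgt0Pr => e e0.
have : \forall s \near t, `|f t - f s| <= e.
  by move/cvgrPdist_le : (@cf t); apply.
move=> /nbhs_ballP[delta /= d0 fd].
(* From 1/delta < k <= 2^(m+k), the dyadic point of level m + k lies within [delta] of [t]. *)
pose k := (Num.truncn delta^-1).+1.
have kd : delta^-1 < k%:R by exact: truncnS_gt.
have /andP[a b] := dyadic_floor_itv (m + k) t0.
have pow0 : 0 < 2 ^+ (m + k) :> R by rewrite exprn_gt0.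
have h1 : `|f t - f ((dyadic_floor (m + k) t)%:R / 2 ^+ (m + k))| <= e.
  apply: fd; rewrite /ball/= ger0_norm; last by rewrite subr_ge0 ler_pdivrMr.
  rewrite ltrBlDr -ltrBlDl ltr_pdivlMr// mulrBl.
  suff : 1 < delta * 2 ^+ (m + k) by move: b; lra.
  rewrite mulrC -ltr_pdivrMr// div1r (lt_le_trans kd)//.
  rewrite -natrX ler_nat (leq_trans (ltnW (ltn_expl k (isT : (1 < 2)%N))))//.
  by rewrite leq_exp2l// leq_addl.
apply: (le_trans (ler_distD (f ((dyadic_floor (m + k) t)%:R / 2 ^+ (m + k))) _ _)).
have := dyadic_chain k nm tm; have : 0 <= r ^+ (m + k) by rewrite exprn_ge0.
by move: h1; lra.
Qed.

(** The dyadic points below [s] and [t] are equal or adjacent, whence 19 = 9 + 1 + 9. *)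
Lemma dyadic_modulus m s t : (n0 <= m)%N -> 0 <= s < 2 ^+ m ->
  0 <= t < 2 ^+ m -> `|s - t| <= 2^-1 ^+ m -> `|f s - f t| <= 19 * r ^+ m.
Proof.
move=> nm; wlog st : s t / s <= t => [hw sm tm st|].
  have [le|/ltW le] := leP s t; first exact: hw.
  by rewrite distrC; apply: hw => //; rewrite distrC.
move=> sm tm; have /andP[s0 _] := sm; have /andP[t0 _] := tm.
have /andP[r0 r1] := r_itv.
rewrite distrC ger0_norm ?subr_ge0// exprVn => stm.
have pow0 : 0 < 2 ^+ m :> R by rewrite exprn_gt0.
have {}stm : t * 2 ^+ m <= s * 2 ^+ m + 1.
  by move: stm; rewrite -ler_pdivlMr// mulrDl mulfK ?gt_eqF// div1r; lra.
have /andP[a b] := dyadic_floor_itv m s0.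
have /andP[a' b'] := dyadic_floor_itv m t0.
have stp : s * 2 ^+ m <= t * 2 ^+ m by rewrite ler_pM2r.
have h1 : (dyadic_floor m s < (dyadic_floor m t).+1)%N.
  by rewrite -(ltr_nat R) -natr1; lra.
have h2 : (dyadic_floor m t < (dyadic_floor m s).+2)%N.
  by rewrite -(ltr_nat R) -natr1 -natr1; lra.
have h3 : `|f ((dyadic_floor m t)%:R / 2 ^+ m) -
    f ((dyadic_floor m s)%:R / 2 ^+ m)| <= r ^+ m.
  have [->|tE] : dyadic_floor m t = dyadic_floor m s \/
      dyadic_floor m t = (dyadic_floor m s).+1.
  - move: h2; rewrite ltnS leq_eqVlt => /orP[/eqP ->|]; first by right.
    by rewrite ltnS => h2; left; apply/eqP; rewrite eqn_leq h2.
  - by rewrite subrr normr0 exprn_ge0.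
  by rewrite tE; apply: f_incr => //; exact: dyadic_floor_lt sm _.
have h4 := dyadic_floor_dist nm sm; have h5 := dyadic_floor_dist nm tm.
rewrite (_ : f s - f t = (f s - f ((dyadic_floor m s)%:R / 2 ^+ m)) -
   (f ((dyadic_floor m t)%:R / 2 ^+ m) - f ((dyadic_floor m s)%:R / 2 ^+ m)) -
   (f t - f ((dyadic_floor m t)%:R / 2 ^+ m))); last by ring.
apply: (le_trans (ler_normB _ _)).
have h6 := ler_normB (f s - f ((dyadic_floor m s)%:R / 2 ^+ m))
   (f ((dyadic_floor m t)%:R / 2 ^+ m) - f ((dyadic_floor m s)%:R / 2 ^+ m)).
by lra.
Qed.
End chaining.

Section dyadic_set.
Context {R : realType} {d : nat}.

Definition dyadic_set (r : R) n0 : set (cpath R d) :=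
  [set a : cpath R d | forall n j i, (n0 <= n)%N -> (j < 4 ^ n)%N ->
    `|a (j.+1%:R / 2 ^+ n) i 0 - a (j%:R / 2 ^+ n) i 0| <= r ^+ n].

Lemma dyadic_set_closed r n0 : closed (dyadic_set r n0).
Proof.
rewrite (_ : dyadic_set r n0 = \bigcap_n \bigcap_j \bigcap_i
  [set a : cpath R d | (n0 <= n)%N -> (j < 4 ^ n)%N ->
    `|a (j.+1%:R / 2 ^+ n) i 0 - a (j%:R / 2 ^+ n) i 0| <= r ^+ n]); last first.
  by apply/seteqP; split => a Ka; [move=> n _ j _ i _; exact: Ka|
    move=> n j i; exact: Ka].
apply: closed_bigI => n _; apply: closed_bigI => j _; apply: closed_bigI => i _.
have [nn|nn] := boolP (n0 <= n)%N; last first.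
  by rewrite (_ : mkset _ = setT)//; apply/seteqP; split => // a _ /=; rewrite (negbTE nn).
have [jn|jn] := boolP (j < 4 ^ n)%N; last first.
  by rewrite (_ : mkset _ = setT)//; apply/seteqP; split => // a _ /= _; rewrite (negbTE jn).
rewrite (_ : mkset _ = (fun a : cpath R d =>
    `|a (j.+1%:R / 2 ^+ n) i 0 - a (j%:R / 2 ^+ n) i 0|) @^-1` [set x | x <= r ^+ n]).
  apply: closed_comp; last exact: closed_le.
  move=> a _; have ca t := @coord_path_continuous R d t i a.
  exact: (cvg_norm (cvgB (ca _) (ca _))).
by apply/seteqP; split => a /=; [apply|].
Qed.

Lemma dyadic_set_compact r n0 : 0 <= r <= 9 / 10 -> compact (dyadic_set r n0).
Proof.
move=> rI; apply: closed_equicontinuous_compact; first exact: dyadic_set_closed.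
move=> T e T0 e0; have /andP[r0 r1] := rI.
have : \forall m \near \oo, r ^+ m <= e / 19.
  have : (fun m => r ^+ m) @ \oo --> (0 : R).
    by apply: cvg_expr; rewrite ger0_norm//; lra.
  move=> /cvgrPdist_le /(_ (e / 19)); rewrite divr_gt0// => /(_ isT).
  by apply: filterS => m; rewrite sub0r normrN ger0_norm// exprn_ge0.
(* The level must be fine enough for [e], at least [n0], and large enough that [0, T] fits below
   2^m. *)
move=> [M _ rM]; pose m := maxn (maxn n0 M) (Num.truncn T).+1.
have rm : r ^+ m <= e / 19.
  by apply: rM; rewrite /= (leq_trans _ (leq_maxl _ _))// leq_maxr.
have nm : (n0 <= m)%N by rewrite (leq_trans _ (leq_maxl _ _))// leq_maxl.
have Tm : T < 2 ^+ m.
  rewrite (lt_le_trans (truncnS_gt T))// -natrX ler_nat.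
  by rewrite (leq_trans (leq_maxr _ _) (ltnW (ltn_expl m (isT : (1 < 2)%N)))).
exists (2^-1 ^+ m); first by rewrite exprn_gt0.
move=> a Ka i s t /andP[s0 sT] /andP[t0 tT] st.
apply: (@le_trans _ _ (19 * r ^+ m)); last by move: rm; lra.
apply: (@dyadic_modulus R (fun t => a t i 0) n0 r rI _ _ m) => //.
- by move=> n j; exact: Ka.
- move=> u; apply: (cvg_comp _ (fun v : 'cV[R]_d => v i 0)).
    exact: cpath_continuous.
  exact: coord_continuous.
- by rewrite s0 (le_lt_trans sT).
- by rewrite t0 (le_lt_trans tT).
Qed.
End dyadic_set.

(** * Tightness *)

Lemma measure_bigsetU_le {R : realType} d (T : measurableType d)
    (mu : {measure set T -> \bar R}) (I : Type) (s : seq I) (A : I -> set T) :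
  (forall i, measurable (A i)) ->
  (mu (\big[setU/set0]_(i <- s) A i) <= \sum_(i <- s) mu (A i))%E.
Proof.
move=> mA; elim: s => [|i s IH]; first by rewrite !big_nil measure0.
rewrite !big_cons (le_trans (measureU2 _ _ _))//.
  by apply: bigsetU_measurable.
by rewrite leeD2l.
Qed.

(** One term of the exponential series bounds exp(y) from below. With y = (6/5)^n this turns a
    doubly exponential tail into a geometric one, which can be summed explicitly. *)
Lemma expRN_le {R : realType} (k : nat) (y : R) : 0 < y ->
  expR (- y) <= k.+1`!%:R / y ^+ k.+1.
Proof.
move=> y0; have yk0 : 0 < y ^+ k.+1 by rewrite exprn_gt0.
have k0 : 0 < k.+1`!%:R :> R by rewrite ltr0n fact_gt0.
rewrite expRN -[leRHS]invf_div lef_pV2 ?posrE ?expR_gt0 ?divr_gt0//.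
by have := expR_ge1Dxn k (ltW y0); apply: le_trans; rewrite lerDr.
Qed.

(** The factor d * 2 counts coordinates and signs, the exponential comes from [ito_tail] with c^2 (t
    - s) <= 1, and the factorial from [expRN_le]. *)
Definition tail_coef {R : realType} (d : nat) (B : R) : R :=
  d%:R * 2 * (expR (d%:R ^+ 2 * B + 1) * 8`!%:R).

(* At level n there are [4 ^ n] increments, each of which is bad with
   probability O(exp (- (6 / 5) ^ n)) = O(((5 / 6) ^ 8) ^ n), where
   6 / 5 = (4 / 3) * (9 / 10). *)
Definition tail_ratio (R : realType) : R := 4 * (5 / 6) ^+ 8.

Lemma tail_coef_ge0 {R : realType} d (B : R) : 0 <= tail_coef d B.
Proof. by rewrite !mulr_ge0 ?expR_ge0. Qed.

(** The eighth power is the first for which 4 (5/6)^k drops below 1. *)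
Lemma tail_ratio_itv (R : realType) : 0 <= tail_ratio R < 1.
Proof. by rewrite mulr_ge0 ?exprn_ge0//= /tail_ratio; lra. Qed.

Lemma geometric_tail_le {R : realType} (c r e : R) : 0 <= r < 1 -> 0 < e ->
  exists n, c * r ^+ n <= e.
Proof.
move=> /andP[r0 r1] e0.
have : \forall n \near \oo, `|0 - c * r ^+ n| <= e.
  have : (fun n => c * r ^+ n) @ \oo --> c * 0.
    by apply: cvgMr; apply: cvg_expr; rewrite ger0_norm.
  by rewrite mulr0 => /cvgrPdist_le /(_ e e0).
move=> [n _ /(_ n (leqnn _))/=]; rewrite sub0r normrN => cr; exists n.
exact: le_trans (ler_norm _) cr.
Qed.

Section tightness.
Context {R : realType} {d : nat} {dO : measure_display}
  {Omega : measurableType dO} {P : probability Omega R}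
  {W : R -> Omega -> 'cV[R]_d}.
Hypothesis hW : brownian_motion P W.
Variables (theta : R -> Omega -> 'M[R]_d) (X : Omega -> cpath R d) (B : R).
Hypothesis mtheta : forall i j,
  measurable_fun ((`[0, +oo[ : set (measurableTypeR R)) `*` [set: Omega])
    (fun p : measurableTypeR R * Omega => theta p.1 p.2 i j).
Hypothesis thetaB : forall v w, 0 <= v -> sqnorm (theta v w) <= B.
Hypothesis B0 : 0 <= B.
Hypothesis mX : measurable_fun setT (X : Omega -> borel (cpath R d)).
Hypothesis thetaX : is_ito_integral P W theta X.

Let measurable_coord_path t i : measurable_fun setT (fun w => X w t i 0).
Proof.
have mc := continuous_measurable_borel (@coord_path_continuous R d t i).
by have := measurableT_comp mc mX.
Qed.

Local Notation C := (tail_coef d B).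
Local Notation q := (tail_ratio R).

(** The boolean is the sign of the increment: with it, a large absolute value is a union of two
    one-sided events, to which [ito_tail] applies with c = (4/3)^n or its opposite. *)
Let bad n (p : 'I_(4 ^ n) * 'I_d * bool) : set Omega :=
  [set w | (6 / 5) ^+ n <= (-1) ^+ p.2 * (4 / 3) ^+ n *
    (X w (p.1.1.+1%:R / 2 ^+ n) - X w (p.1.1%:R / 2 ^+ n)) p.1.2 0].

Let measurable_bad n p : measurable (@bad n p).
Proof.
rewrite -[X in measurable X]setTI.
have mf : measurable_fun setT (fun w => (-1) ^+ p.2 * (4 / 3) ^+ n *
    (X w (p.1.1.+1%:R / 2 ^+ n) - X w (p.1.1%:R / 2 ^+ n)) p.1.2 0).
  apply: measurable_funM => //.
  under [X in measurable_fun _ X]eq_fun do rewrite !mxE.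
  exact: measurable_funB.
by have := mf measurableT _ (measurable_itv `[(6 / 5) ^+ n, +oo[);
  rewrite set_itvcy.
Qed.

Let bad_le n p : (P (@bad n p) <=
  (expR (d%:R ^+ 2 * B + 1) * 8`!%:R * (5 / 6) ^+ 8 ^+ n)%:E)%E.
Proof.
case: p => -[j i] b; have p20 : 0 < 2 ^+ n :> R by rewrite exprn_gt0.
apply: (le_trans (ito_tail hW mtheta thetaB measurable_coord_path _ _ _ thetaX _ _)).
- by rewrite divr_ge0// ltW.
- by rewrite ler_pM2r ?invr_gt0// ler_nat.
rewrite lee_fin /= -[leRHS]mulrA.
(* Here c^2 (t - s) = ((4/3)^2 / 2)^n = (8/9)^n <= 1. *)
apply: (@le_trans _ _ (expR (d%:R ^+ 2 * B + 1) * expR (- (6 / 5) ^+ n))).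
  rewrite -expRD ler_expR lerD2r lerD2r. rewrite -mulrA ler_wpM2l ?sqr_ge0// mulrCA.
  rewrite ler_piMr// exprMn sqrr_sign mul1r.
  rewrite -mulrBl -natrB// subSnn div1r -exprM mulnC exprM -exprVn -exprMn.
  by apply: exprn_ile1; lra.
rewrite ler_pM2l ?expR_gt0//.
have y0 : 0 < (6 / 5) ^+ n :> R by rewrite exprn_gt0.
apply: le_trans (expRN_le 7 y0) _; rewrite ler_wpM2l//.
by rewrite -[5 / 6]invf_div !exprVn -!exprM mulnC.
Qed.

Let Bad n : set Omega := \big[setU/set0]_(p : 'I_(4 ^ n) * 'I_d * bool) @bad n p.

Let measurable_Bad n : measurable (Bad n).
Proof. by apply: bigsetU_measurable => p _; exact: measurable_bad. Qed.

Let Bad_le n : (P (Bad n) <= (C * q ^+ n)%:E)%E.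
Proof.
apply: (le_trans (measure_bigsetU_le _ _ _)); first exact: measurable_bad.
apply: (@le_trans _ _ (\sum_(p : 'I_(4 ^ n) * 'I_d * bool)
  (expR (d%:R ^+ 2 * B + 1) * 8`!%:R * (5 / 6) ^+ 8 ^+ n)%:E)%E).
  by apply: lee_sum => p _; exact: bad_le.
rewrite sumEFin lee_fin sumr_const.
have -> : #|{: 'I_(4 ^ n) * 'I_d * bool}| = (4 ^ n * d * 2)%N.
  by rewrite !card_prod !card_ord card_bool.
rewrite -[leLHS]mulr_natl (natrM R (4 ^ n * d)) (natrM R (4 ^ n)) natrX.
rewrite /tail_coef /tail_ratio (exprMn _ 4 (_ ^+ 8)).
move: (4 ^+ n) ((5 / 6) ^+ 8 ^+ n) (expR _) (8`!%:R : R) => x y z u.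
by rewrite [leLHS](_ : _ = d%:R * 2 * (z * u) * (x * y))//; ring.
Qed.

Let not_dyadic_set n0 :
  [set w | ~ dyadic_set (9 / 10) n0 (X w)] `<=` \bigcup_(n in ~` `I_n0) Bad n.
Proof.
move=> w; apply: contra_notP => nbad n j i nn jn.
rewrite leNgt; apply/negP => Dn; apply: nbad; exists n.
  by apply/negP; rewrite -leqNgt.
set D := (_ - _) in Dn.
have c0 : 0 < (4 / 3) ^+ n :> R by rewrite exprn_gt0.
(* With the boolean D < 0, the signed increment is the absolute value of [D]. *)
rewrite /Bad (bigD1 (Ordinal jn, i, D < 0))//=; left.
rewrite /bad/= !mxE -/D mulrAC -normrEsign.
have -> : 6 / 5 = 9 / 10 * (4 / 3) :> R by field.
by rewrite exprMn mulrC [leRHS]mulrC ler_pM2l// ltW.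
Qed.

Lemma ito_dyadic_set n0 :
  (P [set w | ~ dyadic_set (9 / 10) n0 (X w)] <=
   (C / (1 - q) * q ^+ n0)%:E)%E.
Proof.
have C0 := tail_coef_ge0 d B; have /andP[q0 q1'] := tail_ratio_itv R.
have q1 : 0 < 1 - q by rewrite subr_gt0.
have mK : measurable [set w | ~ dyadic_set (9 / 10) n0 (X w)].
  rewrite -[X in measurable X]setTI.
  apply: (mX measurableT (Y := ~` dyadic_set (9 / 10) n0)).
  apply: sub_sigma_algebra; rewrite /= openC; exact: dyadic_set_closed.
apply: (le_trans (measure_sigma_subadditive_tail P measurable_Bad mK
  (@not_dyadic_set n0))).
apply: lime_le; first by apply: is_cvg_nneseries => n _ _; exact: measure_ge0.
apply: nearW => N.
apply: (@le_trans _ _ (\sum_(n0 <= n < N) (C * q ^+ n)%:E)%E).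
  by apply: lee_sum => n _; exact: Bad_le.
rewrite sumEFin lee_fin.
have [Nn|nN] := leqP N n0.
  by rewrite big_geq// mulr_ge0 ?exprn_ge0// divr_ge0// ltW.
(* The geometric sum telescopes, since q^n = (q^n - q^(n+1)) / (1 - q). *)
apply: (@le_trans _ _ (C / (1 - q) * (q ^+ n0 - q ^+ N))).
  have -> : q ^+ n0 - q ^+ N = \sum_(n0 <= n < N) (- q ^+ n.+1 - - q ^+ n).
    by rewrite telescope_sumr ?(ltnW nN)// opprK addrC.
  rewrite mulr_sumr; apply: ler_sum => n _; rewrite exprS.
  by rewrite le_eqVlt; apply/orP; left; apply/eqP; field; rewrite gt_eqF.
rewrite ler_wpM2l//; first by rewrite divr_ge0// ltW.
by rewrite lerBlDr lerDl exprn_ge0.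
Qed.
End tightness.

Theorem proposition49 (R : realType) (d : nat) (dOmega : measure_display)
    (Omega : measurableType dOmega) (P : probability Omega R) (W : R -> Omega -> 'cV[R]_d)
    (Theta : set 'M[R]_d) (hW : brownian_motion P W)
    (Theta_neq0 : Theta !=set0) (Theta_bounded : bounded_set Theta)
    (Theta_closed : closed Theta) :
  tight (ito_laws P W Theta).
Proof.
have [M [_ TM]] := Theta_bounded.
(* Boundedness gives a bound by every number above [M], whence M + 1; the factor d * d converts the
   max norm into the squared Frobenius norm. *)
pose B : R := (d * d)%:R * (M + 1) ^+ 2.
have B0 : 0 <= B by rewrite mulr_ge0 ?sqr_ge0.
have ThetaB A : Theta A -> sqnorm A <= B.
  move=> TA; have AM : `|A| <= M + 1 by apply: (TM (M + 1)); rewrite ?ltrDl.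
  rewrite (le_trans (sqnorm_le A))// ler_wpM2l// ler_pXn2r// nnegrE//.
  exact: le_trans AM.
move=> e e0.
have /andP[q0 q1] := tail_ratio_itv R.
(* The level [n0] depends only on [d], [B] and [e], so one compact set serves the whole family of
   laws. *)
have [n0 n0P] := geometric_tail_le (tail_coef d B / (1 - tail_ratio R))
  (tail_ratio_itv R) e0.
exists (dyadic_set (9 / 10) n0); split.
  by apply: dyadic_set_compact; lra.
move=> Q [theta [mtheta _ thetaT] [X thetaX ->]].
apply: (@le_trans _ _ (tail_coef d B / (1 - tail_ratio R) *
  tail_ratio R ^+ n0)%:E); last by rewrite lee_fin.
apply: (ito_dyadic_set hW (theta := theta)) => //.
- move=> i j; exact: measurableT_comp (measurable_coord i j) mtheta.
- by move=> v w v0; exact/ThetaB/thetaT.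
Qed.
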